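(* Let $\epsilon\in(0,1)$, let $T = \{ \tau_1, \dots, \tau_n \}$ be a set of polygonal curves in $\mathbb{R}^d$ of complexity at most $m$ each and let $\ell \geq m$. There exists a probability distribution over linear maps $f \colon \mathbb{R}^d \to \mathbb{R}^{d'}$, where $d' \in O(\epsilon^{-2}\log (n\ell))$, such that with high probability over the choice of $f$, the following is true. For any polygonal curve $\tau$ with vertices $v^\tau_1, \dots, v^\tau_{\lvert \tau \rvert}$, define $F(\tau)$ to be the polygonal curve with vertices $f(v^\tau_1), \dots, f(v^\tau_{\lvert \tau \rvert})$. Then \[ \frac{1-\epsilon}{2}\cdot r^{\ast}\leq r_f^{\ast} \leq (1+\epsilon)\cdot r^{\ast}, \] where $r^{\ast}$ is the cost of an optimal solution to the $(k,\ell)$-median problem on $T$, and $r_f^{\ast}$ is the cost of an optimal solution to the $(k,\ell)$-median problem on $F(T)=\{F(\tau):\tau\in T\}$.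
   Context: A curve is a continuous map $\tau\colon[0,1]\to\mathbb{R}^d$; it is polygonal if there are vertices $v_1,\dots,v_m$, no three consecutive on a line, and instants $0=t_1<\dots<t_m=1$ with $\tau(t_i)=v_i$ such that $\tau$ is linear between consecutive instants; $m=|\tau|$ is its complexity. Image curves $F(\tau)$ are piecewise linear through the listed vertices (non-collinearity not required). The Fréchet distance is $d_F(\sigma,\tau)=\inf_{a,b}\max_{t\in[0,1]}\|\sigma(a(t))-\tau(b(t))\|$ over continuous bijections $a,b$ of $[0,1]$ fixing $0$ and $1$. The $(k,\ell)$-median clustering problem on a given set $T$ of $n$ polygonal curves is to compute a set $C$ of $k$ polygonal curves in the same ambient space, of complexity at most $\ell$ each, minimizing the cost $\sum_{\tau\in T}\min_{c\in C}d_F(\tau,c)$; $k\in\mathbb{N}$ and $\ell\in\mathbb{N}_{\ge2}$ are constant parameters of the problem (the constant hidden in the bound on $d'$ may depend on $k$). For $F(T)$ the sum is over $\tau\in T$, i.e. images are counted with multiplicity. ''With high probability'' has the usual meaning: for any prescribed constant $c>0$, with probability at least $1-(n\ell)^{-c}$, the constant hidden in the bound on $d'$ being allowed to depend on $c$. *)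

(* Defs.v *)
From HB Require Import structures.
From mathcomp Require Import all_boot all_order all_algebra.
From mathcomp Require Import all_classical all_reals all_analysis.

Set Implicit Arguments.
Unset Strict Implicit.
Unset Printing Implicit Defensive.

Import Order.TTheory GRing.Theory Num.Theory.
Import numFieldNormedType.Exports.

Local Open Scope classical_set_scope.
Local Open Scope ring_scope.

(* The library norm `|v| on row vectors is the sup norm. *)
Definition enorm (R : realType) (d : nat) (v : 'rV[R]_d) : R :=
  Num.sqrt (\sum_i v ord0 i ^+ 2).

Definition collinear (R : realType) (d : nat) (a b c : 'rV[R]_d) : Prop :=
  exists p u : 'rV[R]_d,
    forall x, x \in [:: a; b; c] -> exists s : R, x = p + s *: u.

Definition pl_wf (R : realType) (d : nat) (vs : seq 'rV[R]_d) (ts : seq R) :=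
  [&& size ts == size vs, (1 < size vs)%N,
      head 0 ts == 0, last 0 ts == 1 & sorted <%R ts].

(* A piecewise linear curve is given by its vertices v_1, ..., v_m and the
   instants 0 = t_1 < ... < t_m = 1 at which it visits them; consecutive
   vertices may be collinear, so that images under linear maps have this type.
   For curves satisfying [polygonal] below, vertices and instants are determined
   by the underlying map (every inner vertex is a genuine corner), so that
   equality of records is equality of maps on [0, 1]. *)
Record plcurve (R : realType) (d : nat) := PLCurve {
  vertices : seq 'rV[R]_d;
  instants : seq R;
  plcurveP : pl_wf vertices instants }.

Definition complexity (R : realType) (d : nat) (tau : plcurve R d) : nat :=
  size (vertices tau).

Definition polygonal (R : realType) (d : nat) (tau : plcurve R d) : Prop :=
  forall i, (i.+2 < complexity tau)%N ->
    ~ collinear (vertices tau)`_i (vertices tau)`_i.+1 (vertices tau)`_i.+2.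

(* The map underlying a piecewise linear curve; only its values on [0, 1] are
   meaningful. For t in ]t_i, t_i+1] exactly i + 1 instants (counted from
   index 0) are smaller than t, see [trajE]. *)
Definition traj (R : realType) (d : nat) (tau : plcurve R d) (t : R) : 'rV[R]_d :=
  let vs := vertices tau in
  let ts := instants tau in
  let i := (count (fun s => s < t) ts).-1 in
  vs`_i + ((t - ts`_i) / (ts`_i.+1 - ts`_i)) *: (vs`_i.+1 - vs`_i).

Lemma trajE (R : realType) (d : nat) (tau : plcurve R d) (i : nat) (t : R) :
  (i.+1 < complexity tau)%N ->
  (instants tau)`_i <= t <= (instants tau)`_i.+1 ->
  traj tau t = (vertices tau)`_i +
    ((t - (instants tau)`_i) / ((instants tau)`_i.+1 - (instants tau)`_i)) *:
      ((vertices tau)`_i.+1 - (vertices tau)`_i).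
Proof.
case: tau => vs ts wf; rewrite /complexity /traj /= => ltiv /andP[le1 le2].
case/and5P: wf => /eqP szE _ _ _ sts; rewrite -szE in ltiv.
have mono j k : (j < size ts)%N -> (k < size ts)%N ->
    (ts`_j < ts`_k) = (j < k)%N.
  by move=> hj hk; apply: lt_sorted_ltn_nth; rewrite ?inE.
have cntE j : (j < size ts)%N -> ts`_j < t ->
    ((j.+1 < size ts)%N -> t <= ts`_j.+1) ->
    count (fun s => s < t) ts = j.+1.
  move=> hj hlt hge; rewrite -(cat_take_drop j.+1 ts) count_cat.
  rewrite (_ : count _ (take _ _) = j.+1); last first.
    rewrite (_ : count _ _ = size (take j.+1 ts)); last first.
      apply/eqP; rewrite -all_count; apply/(all_nthP 0) => k.
      rewrite size_takel // => hk; rewrite nth_take //.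
      have hks : (k < size ts)%N by apply: leq_trans hj.
      apply: le_lt_trans hlt; rewrite leNgt mono // -leqNgt; exact: hk.
    by rewrite size_takel.
  rewrite (_ : count _ (drop _ _) = 0%N) ?addn0 //.
  apply/eqP; rewrite eqn0Ngt -has_count; apply/hasPn => x /(nthP 0)[k].
  rewrite size_drop nth_drop ltn_subRL => hk <-.
  have h1 : (j.+1 < size ts)%N by apply: leq_ltn_trans hk; rewrite leq_addr.
  rewrite -leNgt (le_trans (hge h1)) // leNgt mono // -leqNgt leq_addr //.
have his : (i < size ts)%N by apply: ltnW.
move: le1; rewrite le_eqVlt => /orP[/eqP tE|lt1]; last first.
  by rewrite (cntE i).
rewrite -tE subrr mul0r scale0r addr0.
case: i ltiv le2 his tE => [|i] ltiv le2 his tE.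
  rewrite (_ : count _ ts = 0%N) /=; first by rewrite subrr mul0r scale0r addr0.
  apply/eqP; rewrite eqn0Ngt -has_count; apply/hasPn => x /(nthP 0)[k hk <-].
  by rewrite -leNgt leNgt mono // ltn0.
have hi : (i < size ts)%N by apply: ltnW.
rewrite tE (cntE i) //= -?tE ?mono // divff; first by rewrite scale1r addrC subrK.
by rewrite subr_eq0 gt_eqF // mono.
Qed.

Lemma pl_wf_map (R : realType) (d d' : nat) (f : 'rV[R]_d -> 'rV[R]_d')
    (tau : plcurve R d) :
  pl_wf (map f (vertices tau)) (instants tau).
Proof. by rewrite /pl_wf size_map; exact: plcurveP. Qed.

(* The instants are kept; the Frechet distance is invariant under
   reparametrization, so their choice does not matter. *)
Definition image_curve (R : realType) (d d' : nat)
    (f : {linear 'rV[R]_d -> 'rV[R]_d'}) (tau : plcurve R d) : plcurve R d' :=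
  PLCurve (pl_wf_map f tau).

Definition reparam (R : realType) : set (R -> R) :=
  [set a : R -> R | [/\ {within `[0, 1], continuous a},
                    set_bij `[0, 1]%classic `[0, 1]%classic a, a 0 = 0 & a 1 = 1]].

Definition frechet (R : realType) (d : nat) (sigma tau : plcurve R d) : R :=
  inf [set r : R | exists a b : R -> R, reparam a /\ reparam b /\
    r = sup [set enorm (traj sigma (a t) - traj tau (b t)) | t in `[0, 1]]].

(* The infimum over the finite set C is the minimum over its curves. *)
Definition median_cost (R : realType) (d n : nat)
    (T : 'I_n -> plcurve R d) (C : set (plcurve R d)) : R :=
  \sum_(i < n) inf [set frechet (T i) c | c in C].

Definition feasible (R : realType) (d k l : nat) : set (set (plcurve R d)) :=
  [set C | (C #= `I_k)%card /\
           forall c, C c -> polygonal c /\ (complexity c <= l)%N].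

(* An infimum: since polygonal curves have no three consecutive collinear
   vertices, the feasible set is not closed and the minimum need not exist. *)
Definition opt_median_cost (R : realType) (d n k l : nat)
    (T : 'I_n -> plcurve R d) : R :=
  inf [set median_cost T C | C in @feasible R d k l].

(* Linear maps from R^d to R^d' are represented by matrices acting on row
   vectors, with the Borel sigma-algebra. *)
Notation linmap R d d' := (g_sigma_algebraType (@open 'M[R]_(d, d'))).

(* Images are counted with multiplicity in F(T). *)
Definition jl_median_event (R : realType) (d d' n k l : nat) (eps : R)
    (T : 'I_n -> plcurve R d) : set (linmap R d d') :=
  [set A | let F := @image_curve R d d' (mulmxr (A : 'M[R]_(d, d'))) in
     (1 - eps) / 2 * opt_median_cost k l T <= opt_median_cost k l (F \o T)
       <= (1 + eps) * opt_median_cost k l T].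

(* Main.v *)
Require Import Defs.
From HB Require Import structures.
From mathcomp Require Import all_boot all_order all_algebra.
From mathcomp Require Import all_classical all_reals all_analysis.
From mathcomp Require Import ring lra.

Set Implicit Arguments.
Unset Strict Implicit.
Unset Printing Implicit Defensive.

Import Order.TTheory GRing.Theory Num.Theory.
Import numFieldNormedType.Exports.

Local Open Scope classical_set_scope.
Local Open Scope ring_scope.

(** The distribution may depend on [T], so a point mass at one good matrix [A]
    is enough; [A] is found by the probabilistic method.

    For two edges of curves, all differences of a point of the one and a point
    of the other lie in the span of three vectors. A linear map that almost
    preserves the norms of [e_i] and [e_i + e_j] for an orthonormal basis [e] of
    that span almost preserves all norms in it. Hence a scaled Rademacher matrix
    with O(eps^-2 log (n l)) columns can be chosen to preserve, up to a factor
    1 +- eps / 2, all distances between points of the curves in [T] and in one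
    near-optimal set of centers, and therefore the Frechet distances.

    Upper bound: the images of the near-optimal centers, made polygonal and
    distinct by a small perturbation, are admissible centers for the images of
    [T]. If the optimal cost is 0, there is no multiplicative slack, but every
    linear map is Lipschitz and sends cost 0 to cost 0. Lower bound: replacing
    centers by the closest curves of their clusters at most doubles the cost,
    and distances between the curves of [T] are almost preserved.

    The optimal cost is Lipschitz in the matrix, so the event is closed, hence
    measurable. *)

(** * Rademacher sums and Johnson-Lindenstrauss *)

(** Multiplied by exp(-t^2/2), the left-hand side is non-increasing for t >= 0 and equals 2 at 0.
    The sign of the derivative is the inequality tanh t <= t, stated without division in
    [tanh_le]. *)
Lemma expR_symm_le (R : realType) (x : R) :
  expR x + expR (- x) <= 2 * expR (x ^+ 2 / 2).
Proof.
wlog x0 : x / 0 <= x.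
  move=> H; have [/H//|/ltW xle] := leP 0 x.
  have := H (- x); rewrite opprK sqrrN addrC; apply; by rewrite oppr_ge0.
have tanh_le (y : R) : 0 <= y ->
    (1 - y) * expR y - (1 + y) * expR (- y) <= 0.
  move=> y0.
  pose q (t : R) := (1 - t) * expR t - (1 + t) * expR (- t).
  have dq (t : R) : is_derive t 1 q (- t * (expR t - expR (- t))).
    apply: is_derive_eq; rewrite /GRing.scale /=; ring.
  have [t tI] : exists2 t, t \in `[0, y]%R &
      q y - q 0 = - t * (expR t - expR (- t)) * (y - 0).
    apply: MVT_segment => //.
    by apply: derivable_within_continuous => t _; apply: ex_derive.
  move: tI; rewrite in_itv /= => /andP[t0 _].
  rewrite /q oppr0 expR0 => E.
  suff : t * (expR t - expR (- t)) * y >= 0 by move: E; lra.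
  rewrite !mulr_ge0 // subr_ge0 ler_expR; lra.
pose r (t : R) := expR (- (t ^+ 2 / 2)) * (expR t + expR (- t)).
pose dr (t : R) := expR (- (t ^+ 2 / 2)) *
  ((1 - t) * expR t - (1 + t) * expR (- t)).
have der (t : R) : is_derive t 1 r (dr t).
  by apply: is_derive_eq; rewrite /dr /GRing.scale /=; field.
have [u uI E] : exists2 u, u \in `[0, x]%R & r x - r 0 = dr u * (x - 0).
  apply: MVT_segment => //.
  by apply: derivable_within_continuous => t _; apply: ex_derive.
move: uI; rewrite in_itv /= => /andP[u0 _].
have rx : r x <= 2.
  have : dr u * x <= 0 by rewrite mulr_le0_ge0 // mulr_ge0_le0 ?tanh_le ?expR_ge0.
  move: E; rewrite {2}/r expr0n /= mul0r oppr0 expR0; lra.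
rewrite mulrC -ler_pdivrMl ?expR_gt0 //.
by rewrite -expRN.
Qed.

Definition radsum (R : realType) (d : nat) (v : 'I_d -> R)
    (t : d.-tuple bool) : R :=
  \sum_(i < d) (-1) ^+ tnth t i * v i.

Lemma sum_tupleS (R : realType) (d : nat) (F : d.+1.-tuple bool -> R) :
  \sum_t F t = \sum_(t : d.-tuple bool) F [tuple of true :: t] +
               \sum_(t : d.-tuple bool) F [tuple of false :: t].
Proof.
rewrite (reindex (fun p : bool * d.-tuple bool => [tuple of p.1 :: p.2])) /=.
  rewrite -(pair_big predT predT
    (fun (b : bool) (t : d.-tuple bool) => F [tuple of b :: t])) /=.
  by rewrite big_bool.
exists (fun t => (thead t, [tuple of behead t])) => [[b t] _|t _] /=.
  by rewrite theadE; congr pair; apply/val_inj.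
by rewrite [t in RHS]tuple_eta.
Qed.

Lemma radsum_cons (R : realType) (d : nat) (v : 'I_d.+1 -> R) (b : bool)
    (t : d.-tuple bool) :
  radsum v [tuple of b :: t] =
    (-1) ^+ b * v ord0 + radsum (fun i => v (lift ord0 i)) t.
Proof.
rewrite /radsum big_ord_recl tnth0; congr (_ + _).
by apply: eq_bigr => i _; rewrite tnthS.
Qed.

(** Expanding the squares leaves a common factor times 2 cosh x with x = 2 h a v, bounded by
    [expR_symm_le]. With y = 2 h v^2 it remains that 1 + y <= 1 / (1 - y) and y <= - ln (1 - y). *)
Lemma expR_sign_step (R : realType) (a v h : R) : 0 <= h -> 2 * h * v ^+ 2 < 1 ->
  expR (h * (a - v) ^+ 2) + expR (h * (a + v) ^+ 2) <=
  2 * expR (h * a ^+ 2 / (1 - 2 * h * v ^+ 2) - ln (1 - 2 * h * v ^+ 2) / 2).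
Proof.
move=> h0; set y := 2 * h * v ^+ 2 => y1.
have y0 : 0 <= y by rewrite /y mulr_ge0 ?sqr_ge0 ?mulr_ge0.
set x := 2 * h * a * v.
have -> : h * (a - v) ^+ 2 = h * a ^+ 2 + y / 2 + - x by rewrite /x /y; field.
have -> : h * (a + v) ^+ 2 = h * a ^+ 2 + y / 2 + x by rewrite /x /y; field.
rewrite !(expRD _ x) !(expRD _ (- x)) -mulrDr (addrC (expR (- x))).
apply: (le_trans (ler_wpM2l (expR_ge0 _) (expR_symm_le x))).
rewrite mulrCA -expRD ler_pM2l // ler_expR.
have -> : h * a ^+ 2 + y / 2 + x ^+ 2 / 2 = h * a ^+ 2 * (1 + y) + y / 2.
  by rewrite /x /y; field.
apply: lerD; last first.
  by have := @le_ln1Dx R (- y); rewrite ltrN2 => /(_ y1); lra.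
rewrite ler_pdivlMr ?subr_gt0 //; set q := h * a ^+ 2.
have q0 : 0 <= q by rewrite mulr_ge0 ?sqr_ge0.
by have := mulr_ge0 q0 (sqr_ge0 y); lra.
Qed.

(* The bound is the value of the left-hand side for a Gaussian of variance
   [\sum_i v i ^ 2] instead of the Rademacher sum; in this form it is stable
   under adding one coordinate. *)
Lemma radsum_mgf (R : realType) (d : nat) (v : 'I_d -> R) (a h : R) :
  0 <= h -> 2 * h * (\sum_i v i ^+ 2) < 1 ->
  \sum_t expR (h * (a + radsum v t) ^+ 2) <=
  2 ^+ d * expR (h * a ^+ 2 / (1 - 2 * h * (\sum_i v i ^+ 2)) -
                 ln (1 - 2 * h * (\sum_i v i ^+ 2)) / 2).
Proof.
move=> h0; elim: d v a => [|d IH] v a.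
  rewrite !big_ord0 mulr0 subr0 ln1 mul0r subr0 divr1 mul1r => _.
  rewrite (big_pred1 [tuple]) /=; first by rewrite /radsum big_ord0 addr0.
  by move=> t; rewrite [t]tuple0; apply/esym/eqP/val_inj.
rewrite big_ord_recl /=; set s := \sum_(i < d) _; set w := v ord0 => H.
have s0 : 0 <= s by apply: sumr_ge0 => i _; rewrite sqr_ge0.
have w0 : 0 <= w ^+ 2 by rewrite sqr_ge0.
have Hs : 2 * h * s < 1.
  apply: le_lt_trans H; rewrite mulrDr lerDr.
  by apply: mulr_ge0 => //; exact: mulr_ge0.
have D0 : 0 < 1 - 2 * h * s by rewrite subr_gt0.
have DD0 : 0 < 1 - 2 * h * (w ^+ 2 + s) by rewrite subr_gt0.
(* Summing over the signs of the tail leaves a quadratic exponent with coefficient [h']. By [Dw] the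
   factors of head and tail multiply to the factor of the whole vector, so their logarithms add. *)
pose h' := h / (1 - 2 * h * s).
have h'0 : 0 <= h' by rewrite divr_ge0 // ltW.
have Dw : 1 - 2 * h' * w ^+ 2 = (1 - 2 * h * (w ^+ 2 + s)) / (1 - 2 * h * s).
  by rewrite /h'; field; rewrite gt_eqF.
have Dw0 : 0 < 1 - 2 * h' * w ^+ 2 by rewrite Dw divr_gt0.
rewrite sum_tupleS.
have E (b : bool) : \sum_(t : d.-tuple bool) expR (h * (a + radsum v [tuple of b :: t]) ^+ 2) <=
    2 ^+ d * (expR (h' * (a + (-1) ^+ b * w) ^+ 2)
              * expR (- (ln (1 - 2 * h * s) / 2))).
  under eq_bigr do rewrite radsum_cons addrA.
  apply: (le_trans (IH _ _ Hs)).
  by rewrite -expRD /h' -/w -/s (mulrAC h).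
apply: (le_trans (lerD (E true) (E false))).
rewrite -mulrDr -mulrDl expr1 expr0 mulN1r mul1r (exprSr 2 d) -[leRHS]mulrA.
rewrite ler_pM2l ?exprn_gt0 //.
apply: (le_trans (ler_wpM2r (expR_ge0 _) (expR_sign_step a h'0 _))).
  by rewrite -subr_gt0.
rewrite -[leLHS]mulrA -expRD ler_pM2l // ler_expR Dw lnM ?posrE ?invr_gt0 // lnV ?posrE //.
rewrite le_eqVlt; apply/orP; left; apply/eqP.
by rewrite /h'; field; rewrite !gt_eqF.
Qed.

Lemma radsum_moment2 (R : realType) (d : nat) (v : 'I_d -> R) (a : R) :
  \sum_t (a + radsum v t) ^+ 2 = 2 ^+ d * (a ^+ 2 + \sum_i v i ^+ 2).
Proof.
elim: d v a => [|d IH] v a.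
  rewrite big_ord0 mul1r (big_pred1 [tuple]) /=.
    by rewrite /radsum big_ord0 !addr0.
  by move=> t; rewrite [t]tuple0; apply/esym/eqP/val_inj.
rewrite sum_tupleS big_ord_recl /=.
under eq_bigr do rewrite radsum_cons addrA.
under [X in _ + X]eq_bigr do rewrite radsum_cons addrA.
rewrite !IH (exprS 2 d); ring.
Qed.

(** The bound is the fourth moment of a Gaussian with mean [a] and the same variance. It passes
    through the induction because a coordinate [w] loses only 4 w^4 >= 0. *)
Lemma radsum_moment4 (R : realType) (d : nat) (v : 'I_d -> R) (a : R) :
  \sum_t (a + radsum v t) ^+ 4 <= 2 ^+ d *
    (a ^+ 4 + 6 * a ^+ 2 * (\sum_i v i ^+ 2) + 3 * (\sum_i v i ^+ 2) ^+ 2).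
Proof.
elim: d v a => [|d IH] v a.
  rewrite big_ord0 mul1r (big_pred1 [tuple]) /=.
    by rewrite /radsum big_ord0 !addr0 expr0n mulr0 /= mulr0 !addr0.
  by move=> t; rewrite [t]tuple0; apply/esym/eqP/val_inj.
rewrite sum_tupleS big_ord_recl /=.
under eq_bigr do rewrite radsum_cons addrA.
under [X in _ + X]eq_bigr do rewrite radsum_cons addrA.
apply: (le_trans (lerD (IH _ _) (IH _ _))); rewrite -mulrDr (exprSr 2 d).
rewrite -[leRHS]mulrA ler_pM2l ?exprn_gt0 //.
set s := \sum_(i < d) _; set w := v ord0.
rewrite -subr_ge0 [X in 0 <= X](_ : _ = 4 * w ^+ 4); last by ring.
by rewrite mulr_ge0 // -[4%N]/(2 * 2)%N exprM sqr_ge0.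
Qed.

(** The Chernoff bound stays a sum of exponentials so that the bounds for independent columns can be
    multiplied. With h = e / 8 the exponent is at most - h e + 4 h^2 = - e^2 / 16. *)
Lemma radsum_upper_tail (R : realType) (d : nat) (v : 'I_d -> R) (e : R) :
  0 < e < 1 -> \sum_i v i ^+ 2 = 1 ->
  \sum_t expR (e / 8 * (radsum v t ^+ 2 - (1 + e))) <=
  expR (- (e ^+ 2 / 16)) * 2 ^+ d.
Proof.
move=> /andP[e0 e1] v1; set h := e / 8.
have h0 : 0 <= h by rewrite /h; lra.
have h1 : 2 * h * (\sum_i v i ^+ 2) < 1 by rewrite v1 /h; lra.
have := radsum_mgf 0 h0 h1; rewrite v1 mulr1.
under eq_bigr do rewrite add0r.
rewrite expr0n /= mulr0 mul0r sub0r => H.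
under eq_bigr do rewrite mulrBr expRD.
rewrite -mulr_suml.
apply: (le_trans (ler_wpM2r (expR_ge0 _) H)).
rewrite -mulrA -expRD [leRHS]mulrC ler_pM2l ?exprn_gt0 // ler_expR.
(* This comes from 1 / (1 - 2 h) <= 1 + 2 h + 8 h^2, valid for 0 <= h <= 1/4. *)
have {H} : - ln (1 - 2 * h) <= 2 * h + 8 * h ^+ 2.
  have y0 : 0 < 1 - 2 * h by rewrite /h; lra.
  rewrite -lnV ?posrE // -ler_expR lnK ?posrE ?invr_gt0 //.
  apply: le_trans (expR_ge1Dx _); rewrite -[leLHS]mul1r ler_pdivrMr //.
  rewrite -subr_ge0 [X in 0 <= X](_ : _ = 4 * h ^+ 2 * (1 - 4 * h)); last by ring.
  by rewrite !mulr_ge0 ?sqr_ge0 // /h; lra.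
by rewrite /h; have := sqr_ge0 e; nra.
Qed.

(** The coefficient of the square is negative here, so [radsum_mgf] does not apply. A quadratic
    bound on exp(-y) reduces the claim to the second and fourth moments; the exponent is at most - h
    e + 3 h^2 = - 5 e^2 / 64. *)
Lemma radsum_lower_tail (R : realType) (d : nat) (v : 'I_d -> R) (e : R) :
  0 < e < 1 -> \sum_i v i ^+ 2 = 1 ->
  \sum_t expR (e / 8 * (1 - e - radsum v t ^+ 2)) <=
  expR (- (e ^+ 2 / 16)) * 2 ^+ d.
Proof.
move=> /andP[e0 e1] v1; set h := e / 8.
have h0 : 0 <= h by rewrite /h; lra.
(* Combine 1 + y <= exp y with (1 + y) (1 - y + y^2) = 1 + y^3. *)
have expRN_le (y : R) : 0 <= y -> expR (- y) <= 1 - y + y ^+ 2.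
  move=> y0; rewrite expRN -[leLHS]mul1r ler_pdivrMr ?expR_gt0 //.
  have p0 : 0 <= 1 - y + y ^+ 2 by nra.
  apply: le_trans (ler_wpM2l p0 (expR_ge1Dx y)).
  by rewrite -subr_ge0 [X in 0 <= X](_ : _ = y ^+ 3) ?exprn_ge0 //; ring.
have H (t : d.-tuple bool) : expR (h * (1 - e - radsum v t ^+ 2)) <=
    expR (h * (1 - e)) *
    (1 - h * radsum v t ^+ 2 + h ^+ 2 * radsum v t ^+ 4).
  rewrite mulrBr expRD ler_pM2l ?expR_gt0 //.
  apply: le_trans (expRN_le _ _) _; first by rewrite mulr_ge0 ?sqr_ge0.
  by rewrite exprMn -exprM.
apply: le_trans (ler_sum _ (fun t _ => H t)) _.
rewrite -mulr_sumr big_split sumrB /= -!mulr_sumr.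
have H2 : \sum_t radsum v t ^+ 2 = 2 ^+ d.
  rewrite (eq_bigr (fun t => (0 + radsum v t) ^+ 2)).
    by rewrite radsum_moment2 v1 expr0n add0r mulr1.
  by move=> t _; rewrite add0r.
have H4 : \sum_t radsum v t ^+ 4 <= 2 ^+ d * 3.
  rewrite (eq_bigr (fun t => (0 + radsum v t) ^+ 4)).
    apply: le_trans (radsum_moment4 v 0) _.
    by rewrite v1 !expr0n /= mulr0 mul0r !add0r expr1n mulr1.
  by move=> t _; rewrite add0r.
rewrite H2 {H2} sumr_const card_tuple card_bool.
have -> : 1 *+ (2 ^ d) = 2 ^+ d :> R by rewrite natrX.
set p := 2 ^+ d in H4 *; have p0 : 0 < p by rewrite exprn_gt0.
have : p - h * p + h ^+ 2 * (\sum_(t : d.-tuple bool) radsum v t ^+ 4) <=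
    p * expR (- h + 3 * h ^+ 2).
  apply: le_trans (ler_wpM2l (ltW p0) (expR_ge1Dx _)).
  by have := ler_wpM2l (sqr_ge0 h) H4; lra.
move=> /(ler_wpM2l (expR_ge0 (h * (1 - e))))/le_trans; apply.
rewrite mulrCA [leRHS]mulrC ler_pM2l // -expRD ler_expR.
by rewrite /h; have := sqr_ge0 e; nra.
Qed.

(** A union bound by counting. If every [F] failed at some [i], the sum over [i] of the products
    would be at least 1 for each [F]; but its average over all [F] factorizes over [k] and is at
    most #|I| q^m < 1. *)
Lemma exists_prod_lt1 (R : realType) (I J : finType) (m : nat)
    (g : I -> J -> R) (q : R) :
  (0 < #|J|)%N -> (forall i j, 0 <= g i j) ->
  (forall i, \sum_j g i j <= q * #|J|%:R) -> #|I|%:R * q ^+ m < 1 ->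
  exists F : 'I_m -> J, forall i, \prod_k g i (F k) < 1.
Proof.
move=> J0 g0 gq qm; apply: contrapT => /forallNP H.
have H1 (F : {ffun 'I_m -> J}) : 1 <= \sum_i \prod_k g i (F k).
  have /existsNP[i /negP] := H F; rewrite -leNgt => Hi.
  apply: le_trans Hi _; rewrite (bigD1 i) //= lerDl.
  by apply: sumr_ge0 => *; apply: prodr_ge0.
have : \sum_(F : {ffun 'I_m -> J}) 1 <=
       \sum_(F : {ffun 'I_m -> J}) \sum_i \prod_k g i (F k).
  exact: ler_sum.
rewrite exchange_big /= sumr_const card_ffun card_ord => Hle.
have : \sum_i \sum_(F : {ffun 'I_m -> J}) \prod_k g i (F k) <=
       \sum_(i : I) (q * #|J|%:R) ^+ m.
  apply: ler_sum => i _.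
  rewrite -(bigA_distr_bigA (fun (_ : 'I_m) j => g i j)) /=.
  rewrite prodr_const card_ord; apply: lerXn2r; rewrite ?nnegrE //.
    by apply: sumr_ge0.
  by apply: le_trans (gq i); apply: sumr_ge0.
rewrite sumr_const -[_ *+ #|I|]mulr_natl exprMn mulrA => /(le_trans Hle).
by rewrite natrX ler_pMl ?exprn_gt0 ?ltr0n // leNgt qm.
Qed.

(** * Inner products and embeddings of three-dimensional spans *)

Definition dotr (R : realType) (d : nat) (u v : 'rV[R]_d) : R :=
  \sum_i u ord0 i * v ord0 i.

Lemma dotrC (R : realType) (d : nat) (u v : 'rV[R]_d) : dotr u v = dotr v u.
Proof. by apply: eq_bigr => i _; rewrite mulrC. Qed.

Lemma dotrDl (R : realType) (d : nat) (u v w : 'rV[R]_d) :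
  dotr (u + v) w = dotr u w + dotr v w.
Proof. by rewrite -big_split; apply: eq_bigr => i _; rewrite mxE mulrDl. Qed.

Lemma dotrZl (R : realType) (d : nat) (a : R) (u w : 'rV[R]_d) :
  dotr (a *: u) w = a * dotr u w.
Proof. by rewrite /dotr mulr_sumr; apply: eq_bigr => i _; rewrite mxE mulrA. Qed.

Lemma dotrDr (R : realType) (d : nat) (u v w : 'rV[R]_d) :
  dotr w (u + v) = dotr w u + dotr w v.
Proof. by rewrite dotrC dotrDl !(dotrC w). Qed.

Lemma dotrZr (R : realType) (d : nat) (a : R) (u w : 'rV[R]_d) :
  dotr w (a *: u) = a * dotr w u.
Proof. by rewrite dotrC dotrZl (dotrC w). Qed.

Lemma dotr_ge0 (R : realType) (d : nat) (u : 'rV[R]_d) : 0 <= dotr u u.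
Proof. by apply: sumr_ge0 => i _; rewrite -expr2 sqr_ge0. Qed.

Lemma dotr_eq0 (R : realType) (d : nat) (u : 'rV[R]_d) :
  (dotr u u == 0) = (u == 0).
Proof.
apply/idP/eqP => [|->]; last by rewrite /dotr big1 // => i _; rewrite mxE mul0r.
rewrite psumr_eq0 => [/allP H|i _]; last by rewrite -expr2 sqr_ge0.
apply/rowP => i; rewrite mxE; apply/eqP.
by have := H i (mem_index_enum _); rewrite /= mulf_eq0 orbb.
Qed.

Lemma dotr_CS (R : realType) (d : nat) (u v : 'rV[R]_d) :
  dotr u v ^+ 2 <= dotr u u * dotr v v.
Proof.
have [->|v0] := eqVneq v 0.
  by rewrite -(scale0r (0 : 'rV[R]_d)) !dotrZr !mul0r expr0n mulr0.
have vv : 0 < dotr v v by rewrite lt_def dotr_eq0 v0 dotr_ge0.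
have := dotr_ge0 (dotr v v *: u + (- dotr u v) *: v).
rewrite !(dotrDl, dotrDr, dotrZl, dotrZr) (dotrC v u).
rewrite [X in 0 <= X](_ : _ = dotr v v * (dotr u u * dotr v v - dotr u v ^+ 2));
  last by ring.
by rewrite pmulr_rge0 // subr_ge0.
Qed.

(* The scaled Rademacher matrix sends a unit vector [u] to a vector of squared
   norm [m^-1 \sum_k X_k ^ 2], with independent Rademacher sums [X_k]; the two
   Chernoff bounds are indexed by the boolean. *)
Lemma jl_vectors (R : realType) (V : finType) (d m : nat) (u : V -> 'rV[R]_d)
    (e : R) :
  0 < e < 1 -> (0 < m)%N ->
  (2 * #|V|)%:R * expR (- (e ^+ 2 / 16)) ^+ m < 1 ->
  exists A : 'M[R]_(d, m), forall i,
    `|dotr (u i *m A) (u i *m A) - dotr (u i) (u i)| <= e * dotr (u i) (u i).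
Proof.
move=> e01 m0 Hm.
pose n i := (Num.sqrt (dotr (u i) (u i)))^-1 *: u i.
(* The tail bounds need a unit vector. A zero vector gets weight 0, since every matrix preserves its
   norm. *)
pose g (p : V * bool) (t : d.-tuple bool) :=
  if u p.1 == 0 then 0 else
  if p.2 then expR (e / 8 * (radsum (n p.1 ord0) t ^+ 2 - (1 + e)))
  else expR (e / 8 * (1 - e - radsum (n p.1 ord0) t ^+ 2)).
have n1 i : u i != 0 -> \sum_j n i ord0 j ^+ 2 = 1.
  move=> ui; rewrite [LHS](_ : _ = dotr (n i) (n i)).
    rewrite dotrZl dotrZr mulrA -invfM -expr2 sqr_sqrtr ?dotr_ge0 //.
    by rewrite mulVf // dotr_eq0.
  by apply: eq_bigr => j _; rewrite expr2.
have [|p t|p||F HF] := @exists_prod_lt1 R (V * bool)%type (d.-tuple bool) m g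
    (expR (- (e ^+ 2 / 16))).
- by rewrite card_tuple expn_gt0 card_bool.
- by rewrite /g; case: ifP => // _; case: ifP => _; rewrite expR_ge0.
- rewrite /g card_tuple card_bool natrX.
  case: eqP => [_|/eqP up]; first by rewrite big1 // mulr_ge0 ?expR_ge0 ?exprn_ge0.
  case: p.2; first exact: radsum_upper_tail (n1 _ up).
  exact: radsum_lower_tail (n1 _ up).
- by rewrite card_prod card_bool mulnC.
exists (\matrix_(i, k) ((Num.sqrt m%:R)^-1 * (-1) ^+ tnth (F k) i)) => i.
set A := \matrix_(_, _) _.
have [ui|ui] := eqVneq (u i) 0.
  by rewrite ui mul0mx -(scale0r (0 : 'rV[R]_d)) -(scale0r (0 : 'rV[R]_m))
    !dotrZl !mul0r subr0 normr0 mulr0.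
have uu : 0 < dotr (u i) (u i) by rewrite lt_def dotr_eq0 ui dotr_ge0.
have {}m0 : 0 < m%:R :> R by rewrite ltr0n.
pose S := \sum_k radsum (n i ord0) (F k) ^+ 2.
have nE : u i = Num.sqrt (dotr (u i) (u i)) *: n i.
  by rewrite /n scalerA divff ?scale1r // gt_eqF // sqrtr_gt0.
have -> : dotr (u i *m A) (u i *m A) = dotr (u i) (u i) * (S / m%:R).
  rewrite {1 2}nE -scalemxAl dotrZl dotrZr mulrA -expr2 sqr_sqrtr ?ltW //.
  congr (_ * _); rewrite /S mulr_suml; apply: eq_bigr => k _.
  have -> : (n i *m A) ord0 k = (Num.sqrt m%:R)^-1 * radsum (n i ord0) (F k).
    rewrite mxE /radsum mulr_sumr; apply: eq_bigr => j _.
    by rewrite [A _ _]mxE mulrC -mulrA.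
  by rewrite -expr2 exprMn exprVn sqr_sqrtr ?ltW // mulrC.
rewrite -{2}[dotr _ _]mulr1 -mulrBr normrM gtr0_norm // mulrC ler_pM2r //.
have e0 : 0 < e / 8 by case/andP: e01 => ? _; rewrite divr_gt0.
(* A product of exponentials below 1 has a negative total exponent, which bounds the sum [S] over
   all columns from one side. *)
have up := HF (i, true); have lo := HF (i, false).
have {}up : S <= m%:R * (1 + e).
  move: up; rewrite /g (negbTE ui) /= -expR_sum expR_lt1 -mulr_sumr pmulr_rlt0 //.
  by rewrite sumrB sumr_const card_ord subr_lt0 mulr_natl => /ltW.
have {}lo : m%:R * (1 - e) <= S.
  move: lo; rewrite /g (negbTE ui) /= -expR_sum expR_lt1 -mulr_sumr pmulr_rlt0 //.
  by rewrite sumrB sumr_const card_ord subr_lt0 mulr_natl => /ltW.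
by rewrite ler_norml lerBrDr lerBlDr ler_pdivlMr // ler_pdivrMr //; apply/andP;
  split; lra.
Qed.

(** [n] is a unit vector or 0. The identity [dotr n n *: n = n] covers both cases, so that
    Gram-Schmidt needs no case distinction on linear dependence. *)
Lemma exists_normalized (R : realType) (d : nat) (u : 'rV[R]_d) :
  exists n : 'rV[R]_d, [/\ exists k, u = k *: n, exists k, n = k *: u,
    dotr n n *: n = n & dotr n n <= 1].
Proof.
have [->|u0] := eqVneq u 0.
  exists 0; split; [by exists 0; rewrite scaler0|by exists 0; rewrite scaler0| |].
    by rewrite scaler0.
  by rewrite -(scale0r (0 : 'rV[R]_d)) dotrZl mul0r.
have uu : 0 < dotr u u by rewrite lt_def dotr_eq0 u0 dotr_ge0.
have n1 : dotr ((Num.sqrt (dotr u u))^-1 *: u) ((Num.sqrt (dotr u u))^-1 *: u) = 1.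
  by rewrite dotrZl dotrZr mulrA -invfM -expr2 sqr_sqrtr ?ltW // mulVf ?gt_eqF.
exists ((Num.sqrt (dotr u u))^-1 *: u); split; rewrite ?n1 ?scale1r //.
  exists (Num.sqrt (dotr u u)).
  by rewrite scalerA divff ?scale1r // gt_eqF // sqrtr_gt0.
by exists (Num.sqrt (dotr u u))^-1.
Qed.

(** Gram-Schmidt, where a dependent vector contributes 0 to the basis. *)
Lemma orthonormal3 (R : realType) (d : nat) (p q r : 'rV[R]_d) :
  exists e : 'rV[R]_d * 'rV[R]_d * 'rV[R]_d,
  let: (a, b, c) := e in
  [/\ dotr a b = 0, dotr a c = 0, dotr b c = 0,
      [/\ dotr a a <= 1, dotr b b <= 1 & dotr c c <= 1] &
      forall x y z, exists X Y Z,
        x *: p + y *: q + z *: r = X *: a + Y *: b + Z *: c /\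
        dotr (x *: p + y *: q + z *: r) (x *: p + y *: q + z *: r) =
        X ^+ 2 + Y ^+ 2 + Z ^+ 2].
Proof.
have dotrS (a x : 'rV[R]_d) : dotr a a *: a = a ->
    dotr x a * dotr a a = dotr x a by move=> na; rewrite -[in RHS]na dotrZr mulrC.
have dn (u v n : 'rV[R]_d) : dotr u v = 0 -> (exists k, n = k *: u) ->
    dotr v n = 0.
  by move=> uv [k ->]; rewrite dotrC dotrZl uv mulr0.
have [a [[kp pE] _ na a1]] := exists_normalized p; have sa := dotrS a ^~ na.
have [b [[kq qE] kb nb b1]] := exists_normalized (q + (- dotr q a) *: a).
have sb := dotrS b ^~ nb.
have [c [[kr rE] kc nc c1]] :=
  exists_normalized (r + (- dotr r a) *: a + (- dotr r b) *: b).
have sc := dotrS c ^~ nc.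
have ab : dotr a b = 0.
  by apply: dn kb; rewrite dotrDl dotrZl mulNr sa subrr.
have ac : dotr a c = 0.
  apply: dn kc; rewrite !dotrDl !dotrZl (dotrC b) ab.
  by rewrite mulr0 addr0 mulNr sa subrr.
have bc : dotr b c = 0.
  apply: dn kc; rewrite !dotrDl !dotrZl ab.
  by rewrite mulr0 addr0 mulNr sb subrr.
exists (a, b, c); split => // x y z.
set w := _ + z *: r.
(* Inner products serve as coordinates: they vanish along a zero basis vector, so Pythagoras holds
   in the degenerate cases too. *)
exists (dotr w a), (dotr w b), (dotr w c).
have [X [Y [Z wE]]] : exists X Y Z, w = X *: a + Y *: b + Z *: c.
  exists (x * kp + y * dotr q a + z * dotr r a), (y * kq + z * dotr r b), (z * kr).
  have {}qE : q = kq *: b + dotr q a *: a by rewrite -qE scaleNr subrK.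
  have {}rE : r = kr *: c + dotr r b *: b + dotr r a *: a.
    by rewrite -rE !scaleNr !subrK.
  rewrite /w {1}pE {1}qE {1}rE.
  by rewrite !scalerDr !scalerDl !scalerA; apply/rowP => i; rewrite !mxE; ring.
have wa : dotr w a = X * dotr a a.
  by rewrite wE !dotrDl !dotrZl (dotrC b) (dotrC c) ab ac; ring.
have wb : dotr w b = Y * dotr b b.
  by rewrite wE !dotrDl !dotrZl ab (dotrC c) bc; ring.
have wc : dotr w c = Z * dotr c c.
  by rewrite wE !dotrDl !dotrZl ac bc; ring.
split; first by rewrite wa wb wc -!scalerA na nb nc.
transitivity (X * dotr w a + Y * dotr w b + Z * dotr w c).
  by rewrite {2}wE !dotrDr !dotrZr.
have sq (D t k : R) : D = k * t -> D * t = D -> k * D = D ^+ 2.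
  by move=> E1 E2; rewrite -[in LHS]E2 mulrCA -E1 expr2.
by rewrite (sq _ _ _ wa (sa w)) (sq _ _ _ wb (sb w)) (sq _ _ _ wc (sc w)).
Qed.

(** Each square receives h from the diagonal and 2 h from each of the two mixed terms, which occur
    twice in the form: 5 h in total. *)
Lemma quadratic_form3_le (R : realType) (h X Y Z aa bb cc ab ac bc : R) :
  `|aa| <= h -> `|bb| <= h -> `|cc| <= h ->
  `|ab| <= 2 * h -> `|ac| <= 2 * h -> `|bc| <= 2 * h ->
  `|X * (X * aa + Y * ab + Z * ac) + Y * (X * ab + Y * bb + Z * bc) +
    Z * (X * ac + Y * bc + Z * cc)| <= 5 * h * (X ^+ 2 + Y ^+ 2 + Z ^+ 2).
Proof.
have off u v t : `|t| <= 2 * h -> `|u * v * t| <= h * (u ^+ 2 + v ^+ 2).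
  rewrite !ler_norml => /andP[t1 t2].
  have := @mulr_ge0 _ ((u + v) ^+ 2) (2 * h + t) (sqr_ge0 _).
  have := @mulr_ge0 _ ((u - v) ^+ 2) (2 * h - t) (sqr_ge0 _).
  have := @mulr_ge0 _ ((u + v) ^+ 2) (2 * h - t) (sqr_ge0 _).
  have := @mulr_ge0 _ ((u - v) ^+ 2) (2 * h + t) (sqr_ge0 _).
  have -> : 0 <= 2 * h - t by lra.
  have -> : 0 <= 2 * h + t by lra.
  by move=> /(_ isT)? /(_ isT)? /(_ isT)? /(_ isT)?; apply/andP; split; lra.
have diag u t : `|t| <= h -> `|u ^+ 2 * t| <= h * u ^+ 2.
  by move=> th; rewrite normrM normrX real_normK ?num_real // mulrC ler_wpM2r ?sqr_ge0.
move=> /(diag X) + /(diag Y) + /(diag Z) + /(off X Y) + /(off X Z) + /(off Y Z).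
rewrite !ler_norml => /andP[? ?] /andP[? ?] /andP[? ?] /andP[? ?] /andP[? ?] /andP[? ?].
by apply/andP; split; lra.
Qed.

(** Six vectors per span and two tails per vector give the factor 12; applying [jl_vectors] with e /
    5 turns 16 into 400. *)
Lemma jl_spans (R : realType) (V : finType) (d m : nat) (p q r : V -> 'rV[R]_d)
    (e : R) :
  0 < e < 1 -> (0 < m)%N ->
  (12 * #|V|)%:R * expR (- (e ^+ 2 / 400)) ^+ m < 1 ->
  exists A : 'M[R]_(d, m), forall i x y z w,
    w = x *: p i + y *: q i + z *: r i ->
    `|dotr (w *m A) (w *m A) - dotr w w| <= e * dotr w w.
Proof.
move=> /andP[e0 e1] m0 Hm.
have [E HE] := choice (fun i => orthonormal3 (p i) (q i) (r i)).
pose L i := let: (a, b, c) := E i in [:: a; b; c; a + b; a + c; b + c].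
have [||A HA] := @jl_vectors R (V * 'I_6)%type d m (fun j => nth 0 (L j.1) j.2)
  (e / 5) _ m0.
- by apply/andP; split; lra.
- rewrite card_prod card_ord (mulnC #|V|) mulnA.
  have -> : (e / 5) ^+ 2 / 16 = e ^+ 2 / 400 by field.
  exact: Hm.
exists A => i x y z w wdef.
have := HE i; have H6 (j : 'I_6) := HA (i, j); move: H6; rewrite /L /=.
case: (E i) => -[a b] c H [ab ac bc [a1 b1 c1] /(_ x y z)[X [Y [Z]]]].
rewrite -wdef => -[wE wN].
(* The defect of isometry is a symmetric bilinear form. By polarization, its values at a, b and a +
   b bound the mixed value at (a, b) by 2 (e / 5). *)
pose B u v := dotr (u *m A) (v *m A) - dotr u v.
have BC u v : B u v = B v u by rewrite /B dotrC (dotrC u).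
have BDl u v t : B (u + v) t = B u t + B v t.
  by rewrite /B mulmxDl !dotrDl; ring.
have BZl k u t : B (k *: u) t = k * B u t.
  by rewrite /B -scalemxAl !dotrZl; ring.
have BDr u v t : B t (u + v) = B t u + B t v by rewrite BC BDl !(BC t).
have BZr k u t : B t (k *: u) = k * B t u by rewrite BC BZl (BC t).
rewrite -/(B w w) wN.
have le j (hj : (j < 6)%N) u : nth 0 [:: a; b; c; a + b; a + c; b + c] j = u ->
    `|B u u| <= e / 5 * dotr u u.
  by move=> <-; apply: (H (Ordinal hj)).
have := le 0 isT a erefl; have := le 1 isT b erefl; have := le 2 isT c erefl.
have := le 3 isT _ erefl; have := le 4 isT _ erefl; have := le 5 isT _ erefl.
rewrite /= !(BDl, BDr, dotrDl, dotrDr) (dotrC b a) (dotrC c a) (dotrC c b).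
rewrite (BC b a) (BC c a) (BC c b) ab ac bc wE.
rewrite !(BDl, BDr, BZl, BZr) (BC b a) (BC c a) (BC c b).
have h0 : 0 < e / 5 by rewrite divr_gt0.
have -> : e * (X ^+ 2 + Y ^+ 2 + Z ^+ 2) =
  5 * (e / 5) * (X ^+ 2 + Y ^+ 2 + Z ^+ 2) by field.
have := ler_piMr (ltW h0) a1; have := ler_piMr (ltW h0) b1.
have := ler_piMr (ltW h0) c1.
move: (e / 5) h0 (B a a) (B b b) (B c c) (B a b) (B a c) (B b c).
move=> h h0 aa bb cc mab mac mbc d1 d2 d3.
rewrite !addr0 !add0r !(mulrDr h (dotr _ _)) => H1 H2 H3 H4 H5 H6.
move: H1 H2 H3 H4 H5 H6; rewrite !ler_norml.
move=> /andP[? ?] /andP[? ?] /andP[? ?] /andP[? ?] /andP[? ?] /andP[? ?].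
rewrite -ler_norml.
by apply: quadratic_form3_le; rewrite ?ler_norml; apply/andP; split; lra.
Qed.

(** * Euclidean norm and Frechet distance *)

Lemma enormE (R : realType) (d : nat) (v : 'rV[R]_d) :
  enorm v = Num.sqrt (dotr v v).
Proof. by congr Num.sqrt; apply: eq_bigr => i _; rewrite expr2. Qed.

Lemma enorm_ge0 (R : realType) (d : nat) (v : 'rV[R]_d) : 0 <= enorm v.
Proof. exact: sqrtr_ge0. Qed.

Lemma sqr_enorm (R : realType) (d : nat) (v : 'rV[R]_d) : enorm v ^+ 2 = dotr v v.
Proof. by rewrite enormE sqr_sqrtr ?dotr_ge0. Qed.

Lemma enormZ (R : realType) (d : nat) (a : R) (v : 'rV[R]_d) :
  enorm (a *: v) = `|a| * enorm v.
Proof.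
by rewrite !enormE dotrZl dotrZr mulrA -expr2 sqrtrM ?sqr_ge0 // sqrtr_sqr.
Qed.

Lemma enormN (R : realType) (d : nat) (v : 'rV[R]_d) : enorm (- v) = enorm v.
Proof. by rewrite -scaleN1r enormZ normrN normr1 mul1r. Qed.

Lemma enormB (R : realType) (d : nat) (u v : 'rV[R]_d) :
  enorm (u - v) = enorm (v - u).
Proof. by rewrite -enormN opprB. Qed.

Lemma ler_enormD (R : realType) (d : nat) (u v : 'rV[R]_d) :
  enorm (u + v) <= enorm u + enorm v.
Proof.
rewrite -(@ler_pXn2r _ 2) ?nnegrE ?addr_ge0 ?enorm_ge0 //.
rewrite sqrrD !sqr_enorm dotrDl !dotrDr (dotrC v u).
have : dotr u v <= enorm u * enorm v.
  apply: le_trans (ler_norm _) _.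
  rewrite -(@ler_pXn2r _ 2) ?nnegrE ?mulr_ge0 ?enorm_ge0 //.
  by rewrite real_normK ?num_real // exprMn !sqr_enorm dotr_CS.
by lra.
Qed.

Lemma ler_enorm_dist (R : realType) (d : nat) (u v w : 'rV[R]_d) :
  enorm (u - w) <= enorm (u - v) + enorm (v - w).
Proof. by rewrite -[u - w](subrKA v) ler_enormD. Qed.

(** A crude Lipschitz constant, valid for every matrix; it serves where no near-isometry is
    available. *)
Lemma enorm_mulmx_le (R : realType) (d d' : nat) (A : 'M[R]_(d, d'))
    (v : 'rV[R]_d) :
  enorm (v *m A) <= (\sum_i \sum_j `|A i j|) * enorm v.
Proof.
have vle i : `|v ord0 i| <= enorm v.
  rewrite -(@ler_pXn2r _ 2) ?nnegrE ?enorm_ge0 // sqr_enorm.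
  rewrite real_normK ?num_real // /dotr (bigD1 i) //= -expr2 lerDl.
  by apply: sumr_ge0 => j _; rewrite -expr2 sqr_ge0.
have le1 (w : 'rV[R]_d') : enorm w <= \sum_j `|w ord0 j|.
  have w0 : 0 <= \sum_j `|w ord0 j| by apply: sumr_ge0.
  rewrite -(@ler_pXn2r _ 2) ?nnegrE ?enorm_ge0 // sqr_enorm expr2 mulr_suml.
  apply: ler_sum => j _; apply: le_trans (ler_norm _) _; rewrite normrM ler_wpM2l //.
  by rewrite (bigD1 j) //= lerDl sumr_ge0.
apply: le_trans (le1 _) _; rewrite exchange_big mulr_suml /=.
apply: ler_sum => j _; rewrite mxE; apply: le_trans (ler_norm_sum _ _ _) _.
by rewrite mulr_suml; apply: ler_sum => i _; rewrite normrM mulrC ler_wpM2l.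
Qed.

Lemma enorm_near_isometry (R : realType) (d d' : nat) (u : 'rV[R]_d)
    (v : 'rV[R]_d') (e : R) :
  0 < e < 1 -> `|dotr v v - dotr u u| <= e * dotr u u ->
  (1 - e) * enorm u <= enorm v <= (1 + e) * enorm u.
Proof.
move=> /andP[e0 e1]; rewrite ler_norml -!sqr_enorm => /andP[H1 H2].
have ue := mulr_ge0 (ltW e0) (sqr_ge0 (enorm u)).
have uee := mulr_ge0 (sqr_ge0 e) (sqr_ge0 (enorm u)).
have uee' : e * (e * enorm u ^+ 2) <= e * enorm u ^+ 2.
  by rewrite ler_piMl // ltW.
apply/andP; split; rewrite -(@ler_pXn2r _ 2) ?nnegrE ?mulr_ge0 ?enorm_ge0 //;
  rewrite ?exprMn; try lra.
Qed.

(** The segment and the position on it depend only on the instants. Hence the formula is given for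
    all curves with these instants, in any dimension, including images and perturbations. *)
Lemma traj_segment (R : realType) (d : nat) (tau : plcurve R d) (t : R) :
  0 <= t <= 1 -> exists i lam, [/\ (i.+1 < complexity tau)%N, 0 <= lam <= 1 &
    forall d' (s : plcurve R d'), instants s = instants tau ->
      traj s t = (vertices s)`_i +
                 lam *: ((vertices s)`_i.+1 - (vertices s)`_i)].
Proof.
move=> /andP[t0 t1]; set ts := instants tau.
have cE d' (s : plcurve R d') : size (instants s) = complexity s.
  by have /and5P[/eqP] := plcurveP s.
have /and5P[_ sz /eqP hd0 /eqP lst srt] := plcurveP tau; rewrite -/(complexity tau) -cE in sz.
have mono j k : (j < size ts)%N -> (k < size ts)%N ->
    (ts`_j < ts`_k) = (j < k)%N.
  by move=> hj hk; apply: lt_sorted_ltn_nth; rewrite ?inE.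
have hts : has (>= t) ts.
  apply/hasP; exists 1 => //; rewrite -lst -nth_last mem_nth //.
  by rewrite prednK // ltnW.
have [i [it le1 le2]] :
    exists i, [/\ (i.+1 < size ts)%N, ts`_i <= t & t <= ts`_i.+1].
  (* The segment ends at the first instant that is at least [t]. If that instant is the initial one,
     the first segment is taken instead. *)
  have := nth_find 0 hts; have := before_find 0 (a := >= t) (s := ts).
  move: hts; rewrite has_find; case: (find _ _) => [|k] /= hk bef ge.
    exists 0%N; split => //; first by rewrite nth0 hd0.
    by apply: le_trans ge _; rewrite ltW // mono // ltnW.
  by exists k; split => //; rewrite ltW // ltNge bef.
exists i, ((t - ts`_i) / (ts`_i.+1 - ts`_i)); split.
- by rewrite -cE.
- have D : 0 < ts`_i.+1 - ts`_i by rewrite subr_gt0 mono // ltnW.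
  rewrite ler_pdivrMr // mul1r lerD2r le2 andbT.
  by apply: divr_ge0; [rewrite subr_ge0 | exact: ltW].
- by move=> d' s sE; rewrite (@trajE _ _ _ i) -?cE sE ?le1.
Qed.

Lemma traj_bounded (R : realType) (d : nat) (tau : plcurve R d) :
  exists M, forall t, 0 <= t <= 1 -> enorm (traj tau t) <= M.
Proof.
pose M := \sum_(i < complexity tau) enorm (vertices tau)`_i.
exists (2 * M) => t t01.
have [i [lam [hi /andP[l0 l1] ->//]]] := traj_segment tau t01.
have vM j : (j < complexity tau)%N -> enorm (vertices tau)`_j <= M.
  move=> hj; rewrite /M (bigD1 (Ordinal hj)) //= lerDl.
  by apply: sumr_ge0 => k _; apply: enorm_ge0.
have -> : (vertices tau)`_i + lam *: ((vertices tau)`_i.+1 - (vertices tau)`_i) =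
    (1 - lam) *: (vertices tau)`_i + lam *: (vertices tau)`_i.+1.
  by rewrite scalerBr scalerBl scale1r addrCA addrC.
apply: le_trans (ler_enormD _ _) _; rewrite !enormZ !ger0_norm ?subr_ge0 //.
have := vM _ hi; have := vM _ (ltnW hi).
have := enorm_ge0 (vertices tau)`_i; have := enorm_ge0 (vertices tau)`_i.+1; nra.
Qed.

(** * Reparametrizations and the Frechet distance *)

Lemma reparam_mono (R : realType) (a : R -> R) :
  reparam a -> {in `[0, 1] &, {mono a : x y / x <= y}}.
Proof.
move=> [ca [_ inja _] a0 a1]; apply: segment_continuous_inj_le => //.
  by rewrite a0 a1.
by move=> x y x01 y01; apply: inja; rewrite inE.
Qed.

Lemma reparam_itv (R : realType) (a : R -> R) (t : R) :
  reparam a -> 0 <= t <= 1 -> 0 <= a t <= 1.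
Proof.
move=> [_ [fa _ _] _ _] t01.
by have := fa t; rewrite /= !in_itv /=; apply.
Qed.

Lemma reparam_surj (R : realType) (a : R -> R) (t : R) :
  reparam a -> 0 <= t <= 1 -> exists2 s, 0 <= s <= 1 & a s = t.
Proof.
move=> [_ [_ _ sa] _ _] t01; have := sa t; rewrite /= in_itv /= => /(_ t01)[s].
by rewrite /= in_itv /=; exists s.
Qed.

(** An increasing surjection between intervals is continuous, so order arguments suffice to
    establish reparametrizations. *)
Lemma mono_reparam (R : realType) (a : R -> R) : a 0 = 0 -> a 1 = 1 ->
  {in `[0, 1] &, {mono a : x y / x <= y}} ->
  (forall t, 0 <= t <= 1 -> exists2 s, 0 <= s <= 1 & a s = t) -> reparam a.
Proof.
move=> a0 a1 ma sa.
have sja : set_surj `[0, 1] `[0, 1] a.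
  move=> t; rewrite /= in_itv /= => /sa[s s01 <-].
  by exists s => //; rewrite /= in_itv.
split => //; first by apply: segment_inc_surj_continuous; rewrite ?a0 ?a1.
split => //.
  move=> t /= t01.
  by rewrite in_itv /= -{1}a0 -a1 !ma ?in_itv /= ?lexx ?ler01.
by move=> x y; rewrite !inE; apply: (inc_inj_in ma).
Qed.

Lemma reparam_id (R : realType) : reparam (@id R).
Proof. by apply: mono_reparam => // t t01; exists t. Qed.

Lemma reparam_comp (R : realType) (a b : R -> R) :
  reparam a -> reparam b -> reparam (b \o a).
Proof.
move=> ra rb; have [_ _ a0 a1] := ra; have [_ _ b0 b1] := rb.
apply: mono_reparam; rewrite /= ?a0 ?a1 //.
  move=> x y x01 y01 /=; rewrite (reparam_mono rb) ?(reparam_mono ra) //.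
    by rewrite in_itv /= reparam_itv // -in_itv.
  by rewrite in_itv /= reparam_itv // -in_itv.
move=> t /(reparam_surj rb)[s /(reparam_surj ra)[u u01 <-] <-].
by exists u.
Qed.

Lemma reparam_inv (R : realType) (a : R -> R) : reparam a ->
  exists2 b, reparam b & forall t, 0 <= t <= 1 -> a (b t) = t.
Proof.
move=> ra; have ma := reparam_mono ra; have [_ _ a0 a1] := ra.
have ia := inc_inj_in ma.
(* The value 0 outside the unit interval is arbitrary; it makes the choice total. *)
have inv (t : R) : exists s : R, 0 <= t <= 1 -> 0 <= s <= 1 /\ a s = t.
  have [/(reparam_surj ra)[s s01 st]|t01] := boolP (0 <= t <= 1); first by exists s.
  by exists 0.
have [b hb] := choice inv.
have ab t : 0 <= t <= 1 -> a (b t) = t by move=> /hb[].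
have b01 t : 0 <= t <= 1 -> b t \in `[0, 1]%R by rewrite in_itv /= => /hb[].
have ba t : 0 <= t <= 1 -> b (a t) = t.
  move=> t01; have at01 := reparam_itv ra t01.
  by apply: ia; rewrite ?b01 ?in_itv //= ab.
exists b => //; apply: mono_reparam.
- by rewrite -{1}a0 ba // lexx ler01.
- by rewrite -{1}a1 ba // lexx ler01.
- move=> x y x01 y01; rewrite -ma ?b01 -?in_itv //.
  by rewrite !ab -?in_itv.
- move=> t t01; exists (a t); rewrite ?ba //; exact: reparam_itv.
Qed.

Lemma frechet_set_ge0 (R : realType) (d : nat) (s t : plcurve R d) (a b : R -> R) :
  reparam a -> reparam b ->
  has_sup [set enorm (traj s (a u) - traj t (b u)) | u in `[0, 1]] /\
  0 <= sup [set enorm (traj s (a u) - traj t (b u)) | u in `[0, 1]].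
Proof.
move=> ra rb; set S := [set _ | _ in _].
have S0 : S (enorm (traj s (a 0) - traj t (b 0))).
  by exists 0 => //=; rewrite in_itv /= lexx ler01.
have hS : has_sup S.
  split; first by eexists; exact: S0.
  have [M HM] := traj_bounded s; have [N HN] := traj_bounded t.
  exists (M + N) => _ [u /= u01 <-]; rewrite in_itv /= in u01.
  apply: le_trans (ler_enormD _ _) _; rewrite enormN.
  by rewrite lerD ?HM ?HN // reparam_itv.
split=> //; apply: le_trans (enorm_ge0 (traj s (a 0) - traj t (b 0))) _.
by apply: sup_upper_bound hS _ _.
Qed.

Lemma frechet_le (R : realType) (d : nat) (s t : plcurve R d) (a b : R -> R) (r : R) :
  reparam a -> reparam b ->
  (forall u, 0 <= u <= 1 -> enorm (traj s (a u) - traj t (b u)) <= r) ->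
  frechet s t <= r.
Proof.
move=> ra rb H.
apply: (@le_trans _ _ (sup [set enorm (traj s (a u) - traj t (b u)) | u in `[0, 1]])).
  apply: ge_inf; last by exists a, b.
  by exists 0 => _ [a' [b' [ra' [rb' ->]]]]; have [] := frechet_set_ge0 s t ra' rb'.
apply: ge_sup; first by have [[]] := frechet_set_ge0 s t ra rb.
by move=> _ [u /= u01 <-]; apply: H; rewrite in_itv /= in u01.
Qed.

(** Composing with the inverse of the first reparametrization leaves only the second curve
    reparametrized. The slack [e] is there because the infimum need not be attained. *)
Lemma frechet_approx (R : realType) (d : nat) (s t : plcurve R d) (e : R) : 0 < e ->
  exists b : R -> R, reparam b /\
    forall u, 0 <= u <= 1 -> enorm (traj s u - traj t (b u)) <= frechet s t + e.
Proof.
move=> e0; rewrite /frechet; set S := [set r | _].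
have hS : has_inf S.
  split; last first.
    by exists 0 => _ [a' [b' [ra' [rb' ->]]]]; have [] := frechet_set_ge0 s t ra' rb'.
  by eexists; exists id, id; split; [exact: reparam_id|split; [exact: reparam_id|]].
have [_ [a [b [ra [rb ->]]]] lt] := inf_adherent e0 hS.
have [c rc ac] := reparam_inv ra.
exists (b \o c); split; first exact: reparam_comp.
move=> u u01; apply: le_trans (ltW lt).
apply: sup_upper_bound; first by have [] := frechet_set_ge0 s t ra rb.
exists (c u); last by rewrite /= ac.
by rewrite /= in_itv /= reparam_itv.
Qed.

Lemma frechet_ge0 (R : realType) (d : nat) (s t : plcurve R d) : 0 <= frechet s t.
Proof.
apply: lb_le_inf; last first.
  by move=> _ [a [b [ra [rb ->]]]]; have [] := frechet_set_ge0 s t ra rb.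
by eexists; exists id, id; split; [exact: reparam_id|split; [exact: reparam_id|]].
Qed.

(* Otherwise [lra] and [rewrite] unfold the infimum when comparing terms. *)
Local Opaque frechet.

Lemma frechet_comparison (R : realType) (d d' : nat) (s t : plcurve R d)
    (s' t' : plcurve R d') (L : R) : 0 <= L ->
  (forall u v, 0 <= u <= 1 -> 0 <= v <= 1 ->
     enorm (traj s' u - traj t' v) <= L * enorm (traj s u - traj t v)) ->
  frechet s' t' <= L * frechet s t.
Proof.
move=> L0 H; apply/ler_addgt0Pr => e e0.
(* Dividing by L + 1 rather than L allows L = 0. *)
have e'0 : 0 < e / (L + 1) by rewrite divr_gt0 // ltr_wpDl.
have [b [rb Hb]] := frechet_approx s t e'0.
apply: (frechet_le (@reparam_id R) rb) => u u01.
apply: le_trans (H _ _ u01 (reparam_itv rb u01)) _.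
apply: le_trans (ler_wpM2l L0 (Hb u u01)) _.
rewrite mulrDr lerD2l mulrCA; apply: ler_piMr; first exact: ltW.
rewrite ler_pdivrMr ?ltr_wpDl //.
by rewrite mul1r lerDl.
Qed.

Lemma frechetC (R : realType) (d : nat) (s t : plcurve R d) :
  frechet s t = frechet t s.
Proof.
suff H (p q : plcurve R d) : frechet p q <= frechet q p.
  by apply: le_anti; apply/andP; split; exact: H.
apply/ler_addgt0Pr => e e0; have [b [rb Hb]] := frechet_approx q p e0.
apply: (frechet_le rb (@reparam_id R)) => u u01.
by rewrite enormB; exact: Hb.
Qed.

Lemma frechet_triangle (R : realType) (d : nat) (s t r : plcurve R d) :
  frechet s r <= frechet s t + frechet t r.
Proof.
apply/ler_addgt0Pr => e e0; have e20 : 0 < e / 2 by rewrite divr_gt0.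
have [b [rb Hb]] := frechet_approx s t e20.
have [c [rc Hc]] := frechet_approx t r e20.
apply: (frechet_le (@reparam_id R) (reparam_comp rb rc)) => u u01 /=.
apply: le_trans (ler_enorm_dist _ (traj t (b u)) _) _.
apply: le_trans (lerD (Hb u u01) (Hc _ (reparam_itv rb u01))) _.
by rewrite addrACA -splitr.
Qed.

Lemma frechet_vertices (R : realType) (d : nat) (s t : plcurve R d) (e : R) :
  instants s = instants t ->
  (forall i, (i < complexity s)%N ->
     enorm ((vertices s)`_i - (vertices t)`_i) <= e) ->
  frechet s t <= e.
Proof.
move=> st H; apply: (frechet_le (@reparam_id R) (@reparam_id R)) => u u01.
have [i [l [hi /andP[l0 l1] E]]] := traj_segment s u01.
rewrite !E //= {E}.
set x := _`_i; set y := _`_i.+1; set x' := _`_i; set y' := _`_i.+1.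
have -> : x + l *: (y - x) - (x' + l *: (y' - x')) =
    (1 - l) *: (x - x') + l *: (y - y').
  by apply/rowP => j; rewrite !mxE; ring.
apply: le_trans (ler_enormD _ _) _; rewrite !enormZ !ger0_norm ?subr_ge0 //.
have := H _ hi; have := H _ (ltnW hi); rewrite -/x -/y -/x' -/y' => H1 H2.
have := ler_wpM2l l0 H2; have : 0 <= 1 - l by lra.
by move=> /ler_wpM2l/(_ _ _ H1); lra.
Qed.

Lemma traj_image (R : realType) (d d' : nat) (A : 'M[R]_(d, d'))
    (s : plcurve R d) (u : R) : 0 <= u <= 1 ->
  traj (image_curve (mulmxr A) s) u = traj s u *m A.
Proof.
move=> /(traj_segment s)[i [l [hi _ E]]]; rewrite !E //= {E}.
rewrite !(nth_map 0) ?(ltnW hi) //.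
by rewrite mulmxDl -scalemxAl mulmxBl.
Qed.

(** * Perturbing curves *)

(** Finitely many conditions, each valid for small positive t, hold together below the least
    threshold. This yields generic perturbations. *)
Lemma small_forall (R : realType) (I : finType) (P : I -> R -> Prop) :
  (forall i, exists2 h, 0 < h & forall t, 0 < t < h -> P i t) ->
  exists2 h, 0 < h & forall t, 0 < t < h -> forall i, P i t.
Proof.
move=> H; have {}H i : exists h, 0 < h /\ forall t, 0 < t < h -> P i t.
  by have [h h0 hP] := H i; exists h.
have [h hP] := choice H; exists (\big[Num.min/1]_i h i).
  by apply: lt_bigmin => // i _; have [] := hP i.
move=> t /andP[t0 tl] i; have [_ hPi] := hP i; apply: hPi.
by rewrite t0 (lt_le_trans tl) // bigmin_le.
Qed.

(** Near 0 the nonzero coefficient of lowest degree dominates; the lower powers of t are factored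
    out first. *)
Lemma quadratic_neq0_small (R : realType) (a b c : R) :
  [|| a != 0, b != 0 | c != 0] ->
  exists2 h, 0 < h & forall t, 0 < t < h -> a + b * t + c * t ^+ 2 != 0.
Proof.
have aux (u v w : R) : u != 0 ->
    exists2 h, 0 < h & forall t, 0 < t < h -> u + v * t + w * t ^+ 2 != 0.
  move=> u0; have s0 : 0 < `|v| + `|w| + 1 by rewrite ltr_wpDl ?addr_ge0.
  exists (Num.min 1 (`|u| / (`|v| + `|w| + 1))).
    by rewrite lt_min ltr01 divr_gt0 ?normr_gt0.
  move=> t /andP[t0]; rewrite lt_min ltr_pdivlMr // => /andP[t1 tu].
  apply/negP => /eqP E; have : `|u| <= `|v| * t + `|w| * t ^+ 2.
    rewrite -{1}(gtr0_norm t0) -{1}(ger0_norm (sqr_ge0 t)) -!normrM.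
    apply: le_trans (ler_normD _ _); rewrite -(normrN u).
    by rewrite (_ : - u = v * t + w * t ^+ 2) //; lra.
  have := mulr_ge0 (normr_ge0 v) (ltW t0); have wt := mulr_ge0 (normr_ge0 w) (ltW t0).
  have : `|w| * t ^+ 2 <= `|w| * t by rewrite expr2 mulrA ler_piMr // ltW.
  by lra.
have [->|a0] := eqVneq a 0; last by move=> _; exact: aux.
have [->|b0] := eqVneq b 0 => [/=c0|_].
  exists 1 => // t /andP[t0 _]; rewrite mul0r !add0r mulf_neq0 // expf_neq0 //.
  by rewrite gt_eqF.
have [h h0 H] := aux b c 0 b0; exists h => // t t01; have {}H := H _ t01.
rewrite (_ : 0 + b * t + c * t ^+ 2 = t * (b + c * t + 0 * t ^+ 2)); last by ring.
by rewrite mulf_neq0 //; case/andP: t01 => /gt_eqF ->.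
Qed.

Lemma pl_wf_mkseq (R : realType) (d : nat) (tau : plcurve R d) (f : nat -> 'rV[R]_d) :
  pl_wf (mkseq f (complexity tau)) (instants tau).
Proof. by rewrite /pl_wf size_mkseq; exact: plcurveP. Qed.

Definition set_vertices (R : realType) (d : nat) (tau : plcurve R d)
    (f : nat -> 'rV[R]_d) : plcurve R d := PLCurve (pl_wf_mkseq tau f).

Lemma complexity_set_vertices (R : realType) (d : nat) (tau : plcurve R d)
    (f : nat -> 'rV[R]_d) : complexity (set_vertices tau f) = complexity tau.
Proof. exact: size_mkseq. Qed.

Lemma frechet_set_vertices (R : realType) (d : nat) (tau : plcurve R d)
    (f : nat -> 'rV[R]_d) (e : R) :
  (forall i, (i < complexity tau)%N -> enorm ((vertices tau)`_i - f i) <= e) ->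
  frechet tau (set_vertices tau f) <= e.
Proof.
by move=> H; apply: frechet_vertices => //= i hi; rewrite nth_mkseq // H.
Qed.

Lemma collinear_det (R : realType) (d : nat) (a b c : 'rV[R]_d) (i j : 'I_d) :
  collinear a b c ->
  (b - a) ord0 i * (c - a) ord0 j = (b - a) ord0 j * (c - a) ord0 i.
Proof.
move=> [p [u H]].
have [x ->] := H a ltac:(by rewrite !inE eqxx).
have [y ->] := H b ltac:(by rewrite !inE eqxx orbT).
have [z ->] := H c ltac:(by rewrite !inE eqxx !orbT).
by rewrite !mxE; ring.
Qed.

Lemma collinear_translate (R : realType) (d : nat) (a b c w : 'rV[R]_d) :
  collinear (a + w) (b + w) (c + w) -> collinear a b c.
Proof.
move=> [p [u H]]; exists (p - w), u => x; rewrite !inE => xabc.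
have [|s E] := H (x + w); last by exists s; rewrite addrAC -E addrK.
by rewrite !inE !(inj_eq (addIr w)).
Qed.

Lemma polygonal_translate (R : realType) (d : nat) (tau : plcurve R d)
    (w : 'rV[R]_d) : polygonal tau ->
  polygonal (set_vertices tau (fun i => (vertices tau)`_i + w)).
Proof.
move=> H i; rewrite complexity_set_vertices => hi /=.
rewrite !nth_mkseq ?(ltnW hi) //; last exact: ltnW (ltnW hi).
by move=> /collinear_translate; apply: H.
Qed.

(* Moving the vertices along the parabola [i |-> (i, i ^ 2)]: the determinant
   of two consecutive edges is then quadratic in the size of the perturbation,
   with leading coefficient 2. *)
Lemma polygonal_dense (R : realType) (d : nat) (tau : plcurve R d) (e : R) :
  (1 < d)%N -> 0 < e -> exists2 s : plcurve R d,
    polygonal s /\ complexity s = complexity tau & frechet tau s <= e.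
Proof.
move=> d1 e0; pose v i := (vertices tau)`_i.
pose i0 := Ordinal (ltnW d1); pose i1 := Ordinal d1.
pose q (i : nat) : 'rV[R]_d :=
  i%:R *: delta_mx ord0 i0 + (i ^ 2)%:R *: delta_mx ord0 i1.
have q0 i : q i ord0 i0 = i%:R by rewrite !mxE !eqxx mulr1 mulr0 addr0.
have q1 i : q i ord0 i1 = i%:R ^+ 2 by rewrite !mxE !eqxx mulr1 mulr0 add0r natrX.
pose s t := set_vertices tau (fun i => v i + t *: q i).
have [h h0 H] : exists2 h : R, 0 < h & forall t, 0 < t < h ->
    (* Beyond the last vertex [v] has the default value 0; the determinant argument covers these
       indices as well. *)
    forall i : 'I_(complexity tau),
    ~ collinear (v i + t *: q i) (v i.+1 + t *: q i.+1) (v i.+2 + t *: q i.+2).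
  apply: small_forall => i.
  pose b := v i.+1 - v i; pose c := v i.+2 - v i.
  (* The parabola contributes (1, 2 i + 1) and (2, 4 i + 4) to the differences from vertex i. Their
     determinant is the coefficient 2, whatever the curve. *)
  pose D0 := b ord0 i0 * c ord0 i1 - b ord0 i1 * c ord0 i0.
  pose D1 := b ord0 i0 * (4 * i%:R + 4) + c ord0 i1
             - b ord0 i1 * 2 - c ord0 i0 * (2 * i%:R + 1).
  have [|h h0 Hh] := @quadratic_neq0_small R D0 D1 2.
    by rewrite pnatr_eq0 !orbT.
  exists h => // t /Hh/eqP + /(collinear_det i0 i1) E; apply.
  have ent (x y x' y' : 'rV[R]_d) j : (x + t *: y - (x' + t *: y')) ord0 j =
      (x - x') ord0 j + t * (y ord0 j - y' ord0 j) by rewrite !mxE; ring.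
  move: E; rewrite !ent -/b -/c !q0 !q1 -(natr1 i.+1) -(natr1 i) => /eqP.
  by rewrite -subr_eq0 => /eqP <-; rewrite /D0 /D1; ring.
pose M := \sum_(i < complexity tau) enorm (q i).
have M0 : 0 <= M by apply: sumr_ge0 => *; exact: enorm_ge0.
pose t := Num.min h (e / (M + 1)) / 2.
have m0 : 0 < Num.min h (e / (M + 1)) by rewrite lt_min h0 divr_gt0 // ltr_wpDl.
have t0 : 0 < t by rewrite divr_gt0.
have tm : t < Num.min h (e / (M + 1)).
  by rewrite /t ltr_pdivrMr // ltr_pMr // ltr1n.
move: (tm); rewrite lt_min ltr_pdivlMr ?ltr_wpDl // => /andP[th tM].
exists (s t).
  split; last exact: complexity_set_vertices.
  move=> i; rewrite complexity_set_vertices => hi /=.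
  have hi1 := ltnW hi; have hi2 := ltnW hi1.
  rewrite !nth_mkseq //; apply: (H t _ (Ordinal hi2)); by rewrite t0.
apply: frechet_set_vertices => i hi; rewrite -/(v i) opprD addNKr enormN.
rewrite enormZ gtr0_norm //; apply: le_trans (ltW tM); rewrite ler_pM2l //.
have : enorm (q (Ordinal hi)) <= M.
  by rewrite /M (bigD1 (Ordinal hi)) //= lerDl sumr_ge0 // => *; exact: enorm_ge0.
by move=> /le_trans; apply; rewrite lerDl.
Qed.

(** * Optimal median costs *)

Lemma card_range_ord (U : Type) (k : nat) (g : 'I_k -> U) : (0 < k)%N ->
  injective g -> (range g #= `I_k)%card.
Proof.
move=> k0 gi.
have inv u : exists j, range g u -> g j = u.
  have [[j _ <-]|nu] := pselect (range g u); first by exists j.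
  by exists (Ordinal k0).
have [h hP] := choice inv.
apply/card_set_bijP; exists (fun u => nat_of_ord (h u)); split.
- by move=> u _ /=; exact: ltn_ord.
- move=> u v; rewrite !inE => gu gv /val_inj E.
  by rewrite -(hP _ gu) -(hP _ gv) E.
- move=> j /= jk; exists (g (Ordinal jk)); first by exists (Ordinal jk).
  suff -> : h (g (Ordinal jk)) = Ordinal jk by [].
  by apply: gi; apply: hP; exists (Ordinal jk).
Qed.

Lemma card_ord_enum (U : Type) (k : nat) (C : set U) : (C #= `I_k)%card ->
  exists g : 'I_k -> U, (forall j, C (g j)) /\ forall u, C u -> exists j, g j = u.
Proof.
move=> /card_set_bijP[f [ff fi fs]].
have inv (j : 'I_k) : exists u, C u /\ f u = j.
  by have [u Cu fu] := fs j (ltn_ord j); exists u.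
have [g gP] := choice inv; exists g; split=> [j|u Cu]; first by have [] := gP j.
have fk : (f u < k)%N by exact: ff.
exists (Ordinal fk); have [Cg fg] := gP (Ordinal fk).
by apply: fi; rewrite ?inE.
Qed.

(** Feasible sets have exactly k elements, so repeated centers must be separated. The j-th curve is
    shifted by j t along the first axis; for small t > 0 the initial vertices then differ.
    Translations keep curves polygonal in every dimension. *)
Lemma distinct_translates (R : realType) (d k : nat) (g : 'I_k -> plcurve R d)
    (e : R) : (0 < d)%N -> 0 < e ->
  exists h : 'I_k -> plcurve R d, [/\ injective h,
    forall j, complexity (h j) = complexity (g j),
    forall j, polygonal (g j) -> polygonal (h j) &
    forall j, frechet (g j) (h j) <= e].
Proof.
move=> d0 e0; pose i0 := Ordinal d0.
pose x j := (vertices (g j))`_0 ord0 i0.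
have [r r0 H] : exists2 r : R, 0 < r & forall t, 0 < t < r ->
    forall p : 'I_k * 'I_k, p.1 != p.2 ->
    x p.1 - x p.2 + (p.1%:R - p.2%:R) * t + 0 * t ^+ 2 != 0.
  apply: small_forall => -[i j] /=.
  have [->|ij] := eqVneq i j; first by exists 1.
  have [|r r0 rP] := @quadratic_neq0_small R (x i - x j) (i%:R - j%:R) 0.
    by rewrite (subr_eq0 i%:R) eqr_nat (inj_eq val_inj) ij orbT.
  by exists r => // t /rP.
have k1 : 0 < k%:R + 1 :> R by rewrite ltr_wpDl.
pose t := Num.min r (e / (k%:R + 1)) / 2.
have m0 : 0 < Num.min r (e / (k%:R + 1)) by rewrite lt_min r0 divr_gt0.
have t0 : 0 < t by rewrite divr_gt0.
have tm : t < Num.min r (e / (k%:R + 1)).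
  by rewrite /t ltr_pdivrMr // ltr_pMr // ltr1n.
move: (tm); rewrite lt_min ltr_pdivlMr // => /andP[tr te].
pose w (j : 'I_k) : 'rV[R]_d := (j%:R * t) *: delta_mx ord0 i0.
exists (fun j => set_vertices (g j) (fun i => (vertices (g j))`_i + w j)); split.
- move=> i j E; apply/eqP/negPn/negP => ij.
  have t01 : 0 < t < r by rewrite t0.
  have := H t t01 (i, j) ij; rewrite /= mul0r addr0 => /eqP; apply.
  have cpos (c : plcurve R d) : (0 < complexity c)%N.
    by have /and5P[_ /ltnW] := plcurveP c.
  have : (vertices (set_vertices (g i) (fun k => (vertices (g i))`_k + w i)))`_0
      = (vertices (set_vertices (g j) (fun k => (vertices (g j))`_k + w j)))`_0.
    by rewrite E.
  rewrite /= !nth_mkseq // => /rowP/(_ i0).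
  rewrite !mxE !eqxx !mulr1 -/(x i) -/(x j) => E'.
  by rewrite mulrBl addrACA -opprD -E'; ring.
- by move=> j; exact: complexity_set_vertices.
- by move=> j; exact: polygonal_translate.
- move=> j; apply: frechet_set_vertices => i _.
  rewrite opprD addNKr enormN enormZ.
  have -> : enorm (delta_mx ord0 i0 : 'rV[R]_d) = 1.
    rewrite /enorm (bigD1 i0) //= mxE !eqxx expr1n big1 ?addr0 ?sqrtr1 //.
    by move=> a /negbTE ai; rewrite mxE ai andbF expr0n.
  have jt0 : 0 <= j%:R * t by apply: mulr_ge0 => //; exact: ltW.
  rewrite mulr1 ger0_norm // mulrC.
  apply: le_trans (ltW te); rewrite ler_pM2l //.
  by rewrite ler_wpDr // ler_nat ltnW.
Qed.

Lemma sum_slack_le (R : realType) (n : nat) (e : R) :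
  0 < e -> \sum_(i < n) e / (n%:R + 1) <= e.
Proof.
move=> e0; have n1 : 0 < n%:R + 1 :> R by rewrite ltr_wpDl.
rewrite sumr_const card_ord -mulrnAl ler_pdivrMr // -[e *+ n]mulr_natr.
by rewrite ler_pM2l // lerDl.
Qed.

Lemma median_cost_ge0 (R : realType) (d n : nat) (T : 'I_n -> plcurve R d)
    (C : set (plcurve R d)) : C !=set0 -> 0 <= median_cost T C.
Proof.
move=> [c Cc]; apply: sumr_ge0 => i _; apply: lb_le_inf.
  by exists (frechet (T i) c), c.
by move=> _ [c' _ <-]; exact: frechet_ge0.
Qed.

Lemma feasible_nonempty (R : realType) (d k l : nat) (C : set (plcurve R d)) :
  (0 < k)%N -> feasible k l C -> C !=set0.
Proof.
move=> k0 [/card_ord_enum[g [gC _]] _]; by exists (g (Ordinal k0)).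
Qed.

Lemma opt_median_cost_ge0 (R : realType) (d n k l : nat)
    (T : 'I_n -> plcurve R d) : (0 < k)%N -> 0 <= opt_median_cost k l T.
Proof.
move=> k0; rewrite /opt_median_cost; set S := [set _ | _ in _].
have [S0|/set0P/negP/negPn/eqP ->] := pselect (S !=set0); last by rewrite inf0.
apply: lb_le_inf => // _ [C fC <-]; apply: median_cost_ge0.
exact: feasible_nonempty fC.
Qed.

(** Any tuple of centers, even with repetitions, and any assignment give an upper bound, since
    separating the centers costs arbitrarily little. *)
Lemma opt_median_cost_le (R : realType) (d n k l : nat) (T : 'I_n -> plcurve R d)
    (g : 'I_k -> plcurve R d) (s : 'I_n -> 'I_k) :
  (0 < d)%N -> (0 < k)%N ->
  (forall j, polygonal (g j) /\ (complexity (g j) <= l)%N) ->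
  opt_median_cost k l T <= \sum_i frechet (T i) (g (s i)).
Proof.
move=> d0 k0 gP; apply/ler_addgt0Pr => e e0.
have n1 : 0 < n%:R + 1 :> R by rewrite ltr_wpDl.
have e'0 : 0 < e / (n%:R + 1) by rewrite divr_gt0.
have [h [hi hc hp hd]] := distinct_translates g d0 e'0.
have fC : feasible k l (range h).
  split; first exact: card_range_ord.
  by move=> _ [j _ <-]; rewrite hc; have [/hp] := gP j.
apply: (@le_trans _ _ (median_cost T (range h))).
  apply: ge_inf; last by exists (range h).
  exists 0 => _ [C /(feasible_nonempty k0) C0 <-]; exact: median_cost_ge0.
apply: (@le_trans _ _ (\sum_(i < n) (frechet (T i) (g (s i)) + e / (n%:R + 1)))).
  apply: ler_sum => i _; apply: (@le_trans _ _ (frechet (T i) (h (s i)))).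
    apply: ge_inf; last by exists (h (s i)) => //; exists (s i).
    by exists 0 => _ [c _ <-]; exact: frechet_ge0.
  by apply: le_trans (frechet_triangle _ (g (s i)) _) _; rewrite lerD2l.
by rewrite big_split /= lerD2l sum_slack_le.
Qed.

(** Centers may have collinear vertices, as images under linear maps do. Two dimensions are needed
    because on a line no curve with three vertices is polygonal. *)
Lemma opt_median_cost_le_dim2 (R : realType) (d n k l : nat)
    (T : 'I_n -> plcurve R d) (g : 'I_k -> plcurve R d) (s : 'I_n -> 'I_k) :
  (1 < d)%N -> (0 < k)%N -> (forall j, (complexity (g j) <= l)%N) ->
  opt_median_cost k l T <= \sum_i frechet (T i) (g (s i)).
Proof.
move=> d1 k0 gl; apply/ler_addgt0Pr => e e0.
have n1 : 0 < n%:R + 1 :> R by rewrite ltr_wpDl.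
have e'0 : 0 < e / (n%:R + 1) by rewrite divr_gt0.
have dense j : exists h, [/\ polygonal h, complexity h = complexity (g j) &
    frechet (g j) h <= e / (n%:R + 1)].
  by have [h [hp hc] hd] := polygonal_dense (g j) d1 e'0; exists h.
have [h hP] := choice dense.
apply: le_trans (opt_median_cost_le T (g := h) s (ltnW d1) k0 _) _.
  by move=> j; have [? -> _] := hP j.
apply: (@le_trans _ _ (\sum_(i < n) (frechet (T i) (g (s i)) + e / (n%:R + 1)))).
  apply: ler_sum => i _; have [_ _ hd] := hP (s i).
  by apply: le_trans (frechet_triangle _ (g (s i)) _) _; rewrite lerD2l.
by rewrite big_split /= lerD2l sum_slack_le.
Qed.

Lemma segment_wf (R : realType) (d : nat) :
  pl_wf [:: 0 : 'rV[R]_d; 0] [:: 0 : R; 1].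
Proof. by rewrite /pl_wf /= !eqxx ltr01. Qed.

Lemma opt_median_cost_approx (R : realType) (d n k l : nat)
    (T : 'I_n -> plcurve R d) (e : R) :
  (0 < d)%N -> (0 < k)%N -> (2 <= l)%N -> 0 < e ->
  exists (g : 'I_k -> plcurve R d) (s : 'I_n -> 'I_k),
    (forall j, polygonal (g j) /\ (complexity (g j) <= l)%N) /\
    \sum_i frechet (T i) (g (s i)) <= opt_median_cost k l T + e.
Proof.
move=> d0 k0 l2 e0; have e20 : 0 < e / 2 by rewrite divr_gt0.
pose S := [set median_cost T C | C in @feasible R d k l].
have hS : has_inf S.
  split; last first.
    exists 0 => _ [C /(feasible_nonempty k0) C0 <-]; exact: median_cost_ge0.
  (* The feasible family is nonempty: [k] translates of a constant curve with two vertices, which is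
     polygonal vacuously. This is where l >= 2 enters. *)
  have [h [hi hc hp _]] :=
    distinct_translates (fun _ : 'I_k => PLCurve (segment_wf R d)) d0 ltr01.
  exists (median_cost T (range h)), (range h) => //; split.
    exact: card_range_ord.
  by move=> _ [j _ <-]; rewrite hc; split => //; apply: hp.
have [_ [C fC <-] lt] := inf_adherent e20 hS.
have [[/card_ord_enum[g [gC Cg]] Cp] C0] := (fC, feasible_nonempty k0 fC).
have n1 : 0 < n%:R + 1 :> R by rewrite ltr_wpDl.
have near i : exists j, frechet (T i) (g j) <=
    inf [set frechet (T i) c | c in C] + e / 2 / (n%:R + 1).
  have hi : has_inf [set frechet (T i) c | c in C].
    split; first by have [c Cc] := C0; exists (frechet (T i) c), c.
    by exists 0 => _ [c _ <-]; exact: frechet_ge0.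
  have [_ [c /Cg[j <-] <-] /ltW] := inf_adherent (divr_gt0 e20 n1) hi.
  by exists j.
have [s sP] := choice near.
exists g, s; split => [j|]; first exact: Cp.
apply: le_trans (ler_sum _ (fun i _ => sP i)) _.
rewrite [e in leRHS]splitr addrA big_split /=; apply: lerD; first exact: ltW.
exact: sum_slack_le.
Qed.

(** * Images of curves *)

Lemma jl_curves (R : realType) (I : finType) (d m l : nat) (Z : I -> plcurve R d)
    (e : R) :
  0 < e < 1 -> (0 < m)%N -> (forall i, (complexity (Z i) <= l)%N) ->
  (12 * (#|I| * l) ^ 2)%:R * expR (- (e ^+ 2 / 400)) ^+ m < 1 ->
  exists A : 'M[R]_(d, m), forall i j,
    (1 - e) * frechet (Z i) (Z j) <=
      frechet (image_curve (mulmxr A) (Z i)) (image_curve (mulmxr A) (Z j)) <=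
    (1 + e) * frechet (Z i) (Z j).
Proof.
move=> e01 m0 Zl Hm; have /andP[e0 e1] := e01.
pose vx (p : I * 'I_l) := (vertices (Z p.1))`_p.2.
pose ed (p : I * 'I_l) := (vertices (Z p.1))`_p.2.+1 - (vertices (Z p.1))`_p.2.
(* A difference of points on two edges is the difference of their initial vertices plus multiples of
   the two edge vectors, which gives one span per pair of edges. *)
have [||A HA] := @jl_spans R ((I * 'I_l) * (I * 'I_l))%type d m
    (fun p => vx p.1 - vx p.2) (fun p => ed p.1) (fun p => ed p.2) e e01.
- exact: m0.
- by rewrite !card_prod !card_ord mulnn.
have HD i j u v : 0 <= u <= 1 -> 0 <= v <= 1 ->
    (1 - e) * enorm (traj (Z i) u - traj (Z j) v) <=
      enorm (traj (image_curve (mulmxr A) (Z i)) u -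
             traj (image_curve (mulmxr A) (Z j)) v) <=
    (1 + e) * enorm (traj (Z i) u - traj (Z j) v).
  move=> u01 v01; rewrite !traj_image // -mulmxBl.
  apply: enorm_near_isometry => //.
  have [a [x [ha _ ->//]]] := traj_segment (Z i) u01.
  have [b [y [hb _ ->//]]] := traj_segment (Z j) v01.
  have la : (a < l)%N by apply: leq_trans (Zl i); exact: ltnW.
  have lb : (b < l)%N by apply: leq_trans (Zl j); exact: ltnW.
  apply: (HA ((i, Ordinal la), (j, Ordinal lb)) 1 x (- y)).
  by rewrite /vx /ed /= scale1r scaleNr opprD addrACA addrA.
exists A => i j; apply/andP; split.
  rewrite -ler_pdivlMl ?subr_gt0 //.
  apply: frechet_comparison; first by rewrite invr_ge0 subr_ge0 ltW.
  move=> u v u01 v01; rewrite ler_pdivlMl ?subr_gt0 //.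
  by have /andP[] := HD i j u v u01 v01.
apply: frechet_comparison; first by rewrite addr_ge0 // ltW.
by move=> u v u01 v01; have /andP[] := HD i j u v u01 v01.
Qed.

(* Replace each center by the curve of its cluster whose image is closest to
   it: by the triangle inequality this at most doubles the cost. *)
Lemma opt_image_ge (R : realType) (d d' n k l : nat) (T : 'I_n -> plcurve R d)
    (A : 'M[R]_(d, d')) (e : R) :
  (0 < d)%N -> (0 < d')%N -> (0 < n)%N -> (0 < k)%N -> (2 <= l)%N -> e < 1 ->
  (forall i, polygonal (T i) /\ (complexity (T i) <= l)%N) ->
  (forall i j, (1 - e) * frechet (T i) (T j) <=
     frechet (image_curve (mulmxr A) (T i)) (image_curve (mulmxr A) (T j))) ->
  (1 - e) / 2 * opt_median_cost k l T <=
  opt_median_cost k l (image_curve (mulmxr A) \o T).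
Proof.
move=> d0 d'0 n0 k0 l2 e1 TP HA; apply/ler_addgt0Pr => r r0.
set F := image_curve (mulmxr A).
have [g [s [_ Hs]]] := opt_median_cost_approx (F \o T) d'0 k0 l2 r0.
have rep (j : 'I_k) : exists i0, forall i, s i = j ->
    frechet (F (T i0)) (g j) <= frechet (F (T i)) (g j).
  have [[i1 si1]|nj] := pselect (exists i, s i = j); last first.
    by exists (Ordinal n0) => i si; exfalso; apply: nj; exists i.
  have Pi1 : s i1 == j by apply/eqP.
  have [i0 _ H] := @arg_minP _ R 'I_n i1 (fun i => s i == j)
    (fun i => frechet (F (T i)) (g j)) Pi1.
  by exists i0 => i /eqP si; exact: H.
have [h hP] := choice rep.
apply: le_trans Hs; have e10 : 0 < 1 - e by rewrite subr_gt0.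
rewrite mulrAC ler_pdivrMr // -ler_pdivlMl //.
apply: le_trans (opt_median_cost_le T (g := fun j => T (h j)) s d0 k0 _) _.
  by move=> j; exact: TP.
rewrite ler_pdivlMl // mulr_sumr mulr_suml; apply: ler_sum => i _.
apply: le_trans (HA _ _) _; rewrite -/F.
apply: le_trans (frechet_triangle _ (g (s i)) _) _.
rewrite mulrDr mulr1 lerD2l frechetC; exact: hP.
Qed.

Lemma opt_image_le_sum (R : realType) (d d' n k l : nat) (T : 'I_n -> plcurve R d)
    (A : 'M[R]_(d, d')) (g : 'I_k -> plcurve R d) (s : 'I_n -> 'I_k) (e : R) :
  (1 < d')%N -> (0 < k)%N -> (forall j, (complexity (g j) <= l)%N) ->
  (forall i, frechet (image_curve (mulmxr A) (T i))
                     (image_curve (mulmxr A) (g (s i))) <=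
             e * frechet (T i) (g (s i))) ->
  opt_median_cost k l (image_curve (mulmxr A) \o T) <=
  e * \sum_i frechet (T i) (g (s i)).
Proof.
move=> d'1 k0 gl H.
apply: le_trans (opt_median_cost_le_dim2 (image_curve (mulmxr A) \o T)
  (g := image_curve (mulmxr A) \o g) s d'1 k0 _) _.
  by move=> j; rewrite /complexity /= size_map; exact: gl.
by rewrite mulr_sumr; apply: ler_sum => i _; exact: H.
Qed.

Lemma opt_image_eq0 (R : realType) (d d' n k l : nat) (T : 'I_n -> plcurve R d)
    (A : 'M[R]_(d, d')) :
  (0 < d)%N -> (1 < d')%N -> (0 < k)%N -> (2 <= l)%N ->
  opt_median_cost k l T = 0 ->
  opt_median_cost k l (image_curve (mulmxr A) \o T) <= 0.
Proof.
move=> d0 d'1 k0 l2 T0; apply/ler_addgt0Pr => r r0; rewrite add0r.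
pose L := \sum_i \sum_j `|A i j|.
have L0 : 0 <= L by apply: sumr_ge0 => i _; apply: sumr_ge0.
have r'0 : 0 < r / (L + 1) by rewrite divr_gt0 // ltr_wpDl.
have [g [s [gP]]] := opt_median_cost_approx T d0 k0 l2 r'0.
rewrite T0 add0r => Hs.
apply: le_trans (@opt_image_le_sum _ _ _ _ _ l T A g s L d'1 k0 _ _) _.
- by move=> j; have [] := gP j.
- move=> i; apply: frechet_comparison => // u v u01 v01.
  by rewrite !traj_image // -mulmxBl; exact: enorm_mulmx_le.
- apply: le_trans (ler_wpM2l L0 Hs) _.
  rewrite mulrCA; apply: ler_piMr; first exact: ltW.
  by rewrite ler_pdivrMr ?ltr_wpDl // mul1r lerDl.
Qed.

(** Near-optimal centers for one matrix are reused for the other. The image of [T i] moves by at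
    most [M i] times the entrywise distance of the matrices, as seen with the identity
    parametrization. *)
Lemma opt_image_lipschitz (R : realType) (d d' n k l : nat)
    (T : 'I_n -> plcurve R d) :
  (0 < d')%N -> (0 < k)%N -> (2 <= l)%N ->
  exists M : R, 0 <= M /\ forall A B : 'M[R]_(d, d'),
    `|opt_median_cost k l (image_curve (mulmxr A) \o T) -
      opt_median_cost k l (image_curve (mulmxr B) \o T)| <=
    M * \sum_i \sum_j `|(A - B) i j|.
Proof.
move=> d'0 k0 l2.
have [M MP] := choice (fun i => traj_bounded (T i)).
have M0 i : 0 <= M i.
  apply: le_trans (MP i 0 _); first exact: enorm_ge0.
  by rewrite lexx ler01.
exists (\sum_i M i); split; first exact: sumr_ge0.
suff H (A B : 'M[R]_(d, d')) :
    opt_median_cost k l (image_curve (mulmxr A) \o T) <=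
    opt_median_cost k l (image_curve (mulmxr B) \o T) +
    (\sum_i M i) * \sum_i \sum_j `|(A - B) i j|.
  move=> A B; rewrite ler_norml lerBlDl H andbT lerNl opprB lerBlDl.
  have -> : \sum_i \sum_j `|(A - B) i j| = \sum_i \sum_j `|(B - A) i j|.
    by apply: eq_bigr => i _; apply: eq_bigr => j _; rewrite !mxE distrC.
  exact: H.
apply/ler_addgt0Pr => r r0.
have [g [s [gP Hs]]] :=
  opt_median_cost_approx (image_curve (mulmxr B) \o T) d'0 k0 l2 r0.
apply: le_trans (opt_median_cost_le _ s d'0 k0 gP) _.
rewrite addrAC; apply: le_trans (lerD Hs (lexx _)).
rewrite mulr_suml -big_split /=; apply: ler_sum => i _.
apply: le_trans (frechet_triangle _ (image_curve (mulmxr B) (T i)) _) _.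
rewrite [leLHS]addrC; apply: lerD; first exact: lexx.
apply: (frechet_le (@reparam_id R) (@reparam_id R)) => u u01.
rewrite !traj_image // -mulmxBr mulrC; apply: le_trans (enorm_mulmx_le _ _) _.
by apply: ler_wpM2l; [apply: sumr_ge0 => a _; apply: sumr_ge0|exact: MP].
Qed.

Lemma opt_image_continuous (R : realType) (d d' n k l : nat)
    (T : 'I_n -> plcurve R d) :
  (0 < d')%N -> (0 < k)%N -> (2 <= l)%N ->
  continuous (fun A : 'M[R]_(d, d') =>
    opt_median_cost k l (image_curve (mulmxr A) \o T)).
Proof.
move=> d'0 k0 l2 A; have [M [M0 HM]] := opt_image_lipschitz T d'0 k0 l2.
move=> U /nbhs_ballP[e /= e0 HU].
have D0 : 0 < M * (d * d')%:R + 1 by rewrite ltr_wpDl // mulr_ge0.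
apply/nbhs_ballP; exists (e / (M * (d * d')%:R + 1)); first exact: divr_gt0.
move=> B AB; apply: HU; apply: le_lt_trans (HM A B) _.
have : \sum_(i < d) \sum_(j < d') `|(A - B) i j| <=
    (d * d')%:R * (e / (M * (d * d')%:R + 1)).
  have -> : (d * d')%:R * (e / (M * (d * d')%:R + 1)) =
      \sum_(i < d) \sum_(j < d') e / (M * (d * d')%:R + 1).
    by rewrite !sumr_const !card_ord -mulrnA mulnC mulr_natl.
  apply: ler_sum => i _; apply: ler_sum => j _; rewrite !mxE.
  by case: AB => _ AB; exact: ltW (AB i j).
move=> /(ler_wpM2l M0)/le_lt_trans; apply.
rewrite !mulrA ltr_pdivrMr // [ltRHS]mulrC ltr_pM2r //.
by rewrite ltrDl.
Qed.

Lemma measurable_jl_median_event (R : realType) (d d' n k l : nat) (e : R)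
    (T : 'I_n -> plcurve R d) :
  (0 < d')%N -> (0 < k)%N -> (2 <= l)%N ->
  measurable (jl_median_event (d' := d') k l e T).
Proof.
move=> d'0 k0 l2; rewrite -[X in measurable X]setCK; apply: measurableC.
apply: sub_sigma_algebra; rewrite openC.
pose phi (A : 'M[R]_(d, d')) := opt_median_cost k l (image_curve (mulmxr A) \o T).
rewrite (_ : jl_median_event _ _ _ _ = phi @^-1` `[(1 - e) / 2 *
  opt_median_cost k l T, (1 + e) * opt_median_cost k l T]%classic).
  apply: closed_comp; last exact: interval_closed.
  by move=> A _; exact: opt_image_continuous.
by apply/seteqP; split => A; rewrite /= in_itv.
Qed.

(** * Choice of the dimension and conclusion *)

Lemma mul_expRN_lt1 (R : realType) (N p : R) (m : nat) :
  0 < N -> 0 < p -> p * ln N < m%:R -> N * expR (- p^-1) ^+ m < 1.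
Proof.
move=> N0 p0 H; rewrite -[N in N * _]lnK ?posrE // -expRM_natr -expRD expR_lt1.
by rewrite mulNr subr_lt0 ltr_pdivlMl.
Qed.

Lemma jl_dimension (R : realType) (k : nat) : exists K : R,
  forall (e : R) (n l : nat), 0 < e < 1 -> (0 < n)%N -> (2 <= l)%N ->
  exists m : nat, [/\ (1 < m)%N, m%:R <= K * e ^- 2 * ln (n * l)%N%:R &
    (12 * ((n + k) * l) ^ 2)%:R * expR (- ((e / 2) ^+ 2 / 400)) ^+ m < 1].
Proof.
have b0 : 0 < ln 2 :> R by rewrite ln_gt0 // ltr1n.
pose c : R := ln (12 * k.+1%:R ^+ 2).
have c0 : 0 <= c.
  by rewrite ln_ge0 // mulr_ege1 ?ler1n // exprn_ege1 // ler1n.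
(* By n + k <= (k + 1) n, ln N is at most c + 2 ln (n l); c is absorbed using ln (n l) >= ln 2. The
   last summand pays for rounding up by 2, and 1600 = 4 * 400 stems from the accuracy e / 2. *)
exists (1600 * (c / ln 2 + 2) + 2 / ln 2) => e n l /andP[e0 e1] n0 l2.
pose N : R := (12 * ((n + k) * l) ^ 2)%:R.
have nl0 : (0 < n * l)%N by rewrite muln_gt0 n0 ltnW.
have N1 : (0 < 12 * ((n + k) * l) ^ 2)%N.
  by rewrite muln_gt0 expn_gt0 muln_gt0 addn_gt0 n0 (ltnW l2).
have N0 : 0 < N by rewrite ltr0n.
have lnN : ln N <= c + 2 * ln (n * l)%:R.
  have nlp : 0 < (n * l)%:R :> R by rewrite ltr0n.
  have kp : 0 < 12 * k.+1%:R ^+ 2 :> R by rewrite mulr_gt0 // exprn_gt0.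
  have -> : 2 * ln (n * l)%:R = ln ((n * l)%:R ^+ 2) :> R.
    by rewrite lnXn // mulr_natl.
  rewrite -lnM ?posrE ?exprn_gt0 // ler_ln ?posrE ?mulr_gt0 ?exprn_gt0 //.
  rewrite /N -!natrX -!natrM ler_nat -mulnA leq_mul2l /= -expnMn leq_exp2r //.
  by rewrite mulnA leq_mul2r mulSn leq_add2l leq_pmulr // orbT.
pose X : R := 1600 * e ^- 2 * ln N.
have rate : (e / 2) ^+ 2 / 400 = (1600 * e ^- 2)^-1.
  by field; rewrite gt_eqF.
have p0 : 0 < 1600 * e ^- 2 by apply: mulr_gt0; rewrite ?ltr0n ?invr_gt0 ?exprn_gt0.
have lnN0 : 0 <= ln N by rewrite ln_ge0 // ler1n.
have X0 : 0 <= X by apply: mulr_ge0 lnN0; exact: ltW.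
have /andP[tX Xt] := truncn_itv X0.
(* Adding 2 to the integer part exceeds [X] and makes the dimension at least 2, as perturbing the
   image centers requires. *)
exists (Num.truncn X).+2; split; first by [].
  have L0 : ln 2 <= ln (n * l)%:R :> R.
    rewrite ler_ln ?posrE ?ltr0n // ler_nat.
    by apply: leq_trans l2 _; rewrite leq_pmull.
  have q1 : 1 <= e ^- 2 by rewrite invf_ge1 ?exprn_gt0 // exprn_ile1 // ltW.
  have L1 : 1 <= ln (n * l)%:R / ln 2 :> R by rewrite ler_pdivlMr // mul1r.
  have H1 : 2 <= 2 / ln 2 * e ^- 2 * ln (n * l)%:R :> R.
    rewrite (_ : 2 / ln 2 * e ^- 2 * _ = 2 * (e ^- 2 * (ln (n * l)%:R / ln 2)));
      last by ring.
    by rewrite ler_peMr // mulr_ege1.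
  have H2 : c <= c / ln 2 * ln (n * l)%:R :> R.
    by rewrite mulrAC -mulrA ler_peMr.
  have H3 : X <= 1600 * e ^- 2 * ((c / ln 2 + 2) * ln (n * l)%:R).
    rewrite /X (ler_pM2l p0); apply: le_trans lnN _.
    by rewrite [leRHS]mulrDl; exact: lerD H2 (lexx _).
  rewrite -addn2 natrD; apply: le_trans (lerD tX (lexx _)) _.
  apply: le_trans (lerD H3 H1) _; rewrite le_eqVlt; apply/orP; left; apply/eqP.
  by ring.
rewrite rate; apply: (mul_expRN_lt1 N0 p0); apply: lt_trans Xt _.
by rewrite ltr_nat.
Qed.

Theorem theorem21 (R : realType) (k : nat) (c : R) (hk : (0 < k)%N)
    (hc : 0 < c) :
  exists K : R,
  forall (eps : R) (d n m l : nat) (T : 'I_n -> plcurve R d),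
    0 < eps < 1 -> (0 < d)%N -> (0 < n)%N -> (2 <= l)%N -> (m <= l)%N ->
    injective T ->
    (forall i, polygonal (T i) /\ (complexity (T i) <= m)%N) ->
    exists (d' : nat) (P : probability (linmap R d d') R),
      [/\ (0 < d')%N,
          d'%:R <= K * eps ^- 2 * ln (n * l)%N%:R,
          measurable (jl_median_event (d' := d') k l eps T) &
          ((1 - (n * l)%N%:R `^ (- c))%:E <=
             P (jl_median_event (d' := d') k l eps T))%E].
Proof.
have [K HK] := jl_dimension R k; exists K.
move=> e d n m l T e01 d0 n0 l2 ml _ TP; have /andP[e0 e1] := e01.
have {}TP i : polygonal (T i) /\ (complexity (T i) <= l)%N.
  by have [? cT] := TP i; split => //; exact: leq_trans ml.
have [d' [d'1 d'K Hd']] := HK e n l e01 n0 l2.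
have d'0 := ltnW d'1.
set r := opt_median_cost k l T.
have r0 : 0 <= r by exact: opt_median_cost_ge0.
(* For r > 0 the slack fits because (1 + e / 2) (1 + e / 4) <= 1 + e. For r = 0 any positive slack
   will do, since the upper bound then comes from [opt_image_eq0]. *)
have w0 : 0 < (if r == 0 then 1 else e / 4 * r).
  by case: eqP => // /eqP rn0; rewrite mulr_gt0 ?divr_gt0 // lt_def rn0.
have [g [s [gP Hs]]] := opt_median_cost_approx T d0 hk l2 w0.
have e20 : 0 < e / 2 < 1 by apply/andP; split; lra.
(* Input curves and centers are embedded jointly: pairs of inputs give the lower bound, pairs of an
   input and its center the upper bound. *)
pose Z (x : 'I_n + 'I_k) := match x with inl i => T i | inr j => g j end.
have [||A HA] := @jl_curves R ('I_n + 'I_k)%type d d' l Z (e / 2) e20 d'0.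
- by case=> [i|j]; [have [] := TP i|have [] := gP j].
- by rewrite card_sum !card_ord.
have good : jl_median_event k l e T (A : linmap R d d').
  rewrite /jl_median_event /= -/r; apply/andP; split.
    have lo := @opt_image_ge R d d' n k l T A (e / 2) d0 d'0 n0 hk l2.
    apply: le_trans (lo _ TP _); first by rewrite ler_wpM2r //; lra.
      lra.
    by move=> i j; have /andP[] := HA (inl i) (inl j).
  have [rE|rn0] := eqVneq r 0.
    by rewrite rE mulr0; exact: opt_image_eq0.
  rewrite (negbTE rn0) in Hs.
  apply: le_trans (@opt_image_le_sum _ _ _ _ _ l T A g s (1 + e / 2) d'1 hk _ _) _.
  - by move=> j; have [] := gP j.
  - by move=> i; have /andP[] := HA (inl i) (inr (s i)).
  have p0 : 0 <= 1 + e / 2 by lra.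
  apply: le_trans (ler_wpM2l p0 Hs) _; rewrite -/r.
  have er := mulr_ge0 (ltW e0) r0.
  have : 0 <= e * r * (1 - e) by apply: mulr_ge0 er _; rewrite subr_ge0 ltW.
  by clearbody r; lra.
(* The Dirac measure at [A] gives the event probability 1. *)
exists d', (\d_(A : linmap R d d')); split => //.
  exact: measurable_jl_median_event.
rewrite /= diracE mem_set //= lee_fin lerBlDr lerDl.
exact: powR_ge0.
Qed.
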